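(* Suppose the following two sets of conditions hold, where the functions $f_x,f_e,h_e$ are those of the networked control system described in the context. (A) (Uniformly globally asymptotically stable protocol) There exist $W:\mathbb{R}_{\ge0}\times\mathbb{R}^{n_e}\to\mathbb{R}_{\ge 0}$, with $W$ locally Lipschitz in $e$, $\underline\alpha_W,\overline\alpha_W\in\mathcal{K}_\infty$ and $\rho\in(0,1)$ such that for all $(\kappa,e)\in\mathbb{Z}_{\ge 0}\times\mathbb{R}^{n_e}$: $\underline\alpha_W(|e|)\le W(\kappa,e)\le\overline\alpha_W(|e|)$ and $W(\kappa+1,h_e(\kappa,e))\le\rho W(\kappa,e)$. (B) There exist a locally Lipschitz function $V:\mathbb{R}^{n_x}\to\mathbb{R}$, continuous functions $H:\mathbb{R}^{n_x}\to\mathbb{R}_{\ge0}$ and $L,G:\mathbb{R}^{n_x+n_e}\to\mathbb{R}_{\ge0}$, functions $\underline\alpha_V,\overline\alpha_V\in\mathcal{K}_\infty$, and a continuous positive definite function $\varrho:\mathbb{R}\to\mathbb{R}$ such that: (i) for all $(x,e,\kappa)\in\mathbb{R}^{n_x+n_e}\times\mathbb{Z}_{\ge0}$, $W^\circ(e;f_e(x,e))\le L(x,e)W(\kappa,e)+H(x)$, where $W^\circ(e;v)$ is the Clarke generalized directional derivative of $e\mapsto W(\kappa,e)$ (with $\kappa$ fixed) at $e$ in direction $v$; (ii) for all $x\in\mathbb{R}^{n_x}$, $\underline\alpha_V(|x|)\le V(x)\le\overline\alpha_V(|x|)$; (iii) for all $(x,e,\kappa)\in\mathbb{R}^{n_x+n_e}\times\mathbb{Z}_{\ge0}$,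 $V^\circ(x;f_x(x,e))\le-\varrho(|x|)-\varrho(|e|)-H^2(x)+G(x,e)W^2(\kappa,e)$. Let $a\in(\rho,\infty)$ be any constant and consider the hybrid system with state $q=(x,e,\kappa,\eta)\in\mathbb{R}^{n_x}\times\mathbb{R}^{n_e}\times\mathbb{Z}_{\ge 0}\times\mathbb{R}$ $$\dot x=f_x(x,e),\quad \dot e=f_e(x,e),\quad \dot\kappa=0,\quad \dot\eta=-2\eta L(x,e)-\eta^2-G(x,e)\qquad\text{for } q\in C,$$ $$x^+=x,\quad e^+=h_e(\kappa,e),\quad \kappa^+=\kappa+1,\quad \eta^+=a\qquad\text{for } q\in D,$$ with $C=\{q:\eta\in[a\rho^2,a]\}$ and $D=\{q:\eta=a\rho^2\}$. Then the set $\mathcal{A}=\{q:(x,e)=0\}$ is S-GAS for this hybrid system, and the solutions of this system have a semiglobal dwell time on $\mathbb{R}^{n_q}\setminus\mathcal{A}$, where $n_q=n_x+n_e+2$.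
   Context: Hybrid systems. Solutions $\phi$ of a hybrid system $\dot q=f_q(q)$, $q\in C$; $q^+=h_q(q)$, $q\in D$ are hybrid arcs in the sense of Goebel and Teel: $\phi$ is defined on a hybrid time domain $\operatorname{dom}\phi\subset\mathbb{R}_{\ge 0}\times\mathbb{Z}_{\ge 0}$, is locally absolutely continuous in $t$ for each fixed $j$, satisfies $\phi(t,j)\in C$ and $\dot\phi(t,j)=f_q(\phi(t,j))$ during flows (for almost all $t$ for the differential equation), and satisfies $\phi(t,j)\in D$, $\phi(t,j+1)=h_q(\phi(t,j))$ whenever $(t,j),(t,j+1)\in\operatorname{dom}\phi$; $\phi(0,0)\in C\cup D$. On $C\cap D$ a solution may jump, or flow if flowing keeps it in $C$. Comparison functions. $\mathcal{K}_\infty$: continuous, strictly increasing, unbounded functions $\mathbb{R}_{\ge0}\to\mathbb{R}_{\ge0}$ vanishing at $0$. $\beta:\mathbb{R}_{\ge0}^3\to\mathbb{R}_{\ge0}$ is of class $\mathcal{KLL}$ if $\beta(\cdot,\cdot,r)\in\mathcal{KL}$ and $\beta(\cdot,r,\cdot)\in\mathcal{KL}$ for every $r\ge0$. A function $\varrho$ is positive definite if $\varrho(0)=0$ and $\varrho(s)>0$ for $s\ne0$. $|q|_{\mathcal{A}}$ is the distance from $q$ to $\mathcal{A}$; here $|q|_{\mathcal A}=|(x,e)|$. S-GAS. A closed set $\mathcal{A}$ is S-GAS if for every $\Delta>0$ there is $\beta_\Delta\in\mathcal{KLL}$ such that every solution $\phi$ with $|\phi(0,0)|_{\mathcal{A}}<\Delta$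 satisfies $|\phi(t,j)|_{\mathcal{A}}\le\beta_\Delta(|\phi(0,0)|_{\mathcal{A}},t,j)$ for all $(t,j)\in\operatorname{dom}\phi$. Semiglobal dwell time on $\mathbb{R}^{n_q}\setminus\mathcal{A}$. For every $\Delta>0$ there is $\tau(\Delta)>0$ such that, for every solution $\phi$ with $|\phi(0,0)|_{\mathcal{A}}<\Delta$, any two successive jumps are separated by at least $\tau(\Delta)$ units of time as long as the solution is outside $\mathcal{A}$; that is, for all $(s,i),(t,j)\in\operatorname{dom}\phi$ with $s\le t$, $i\le j$ and such that $\phi(t',j')\notin\mathcal{A}$ for all $(t',j')\in\operatorname{dom}\phi$ with $s\le t'\le t$, $i\le j'\le j$, one has $j-i\le\frac{t-s}{\tau(\Delta)}+1$. Clarke derivative. For $U$ locally Lipschitz, $U^\circ(z;v)=\limsup_{y\to z,\,h\to0^+}\frac{U(y+hv)-U(y)}{h}$. Networked control system. The plant is $\dot x_P=f_P(x_P,\hat u)$ with state $x_P\in\mathbb{R}^{n_P}$, the controller is $\dot x_C=f_C(x_C,\hat x_P)$, $u=g_C(x_C,\hat x_P)$ with $x_C\in\mathbb{R}^{n_C}$, $u\in\mathbb{R}^{n_u}$. Between transmissions the networked values evolve by $\dot{\hat x}_P=\hat f_P(x_P,x_C,\hat x_P,\hat u)$, $\dot{\hat u}=\hat f_C(x_P,x_C,\hat x_P,\hat u)$. Set $x=(x_P,x_C)\in\mathbb{R}^{n_x}$ and $e=(e_{x_P},e_u)=(\hat x_P-x_P,\hat u-u)\in\mathbb{R}^{n_e}$.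 With $\hat x_P=x_P+e_{x_P}$ and $\hat u=g_C(x_C,\hat x_P)+e_u$, $$f_x(x,e)=\begin{pmatrix}f_P(x_P,\hat u)\\ f_C(x_C,\hat x_P)\end{pmatrix},\qquad f_e(x,e)=\begin{pmatrix}\hat f_P(x_P,x_C,\hat x_P,\hat u)-f_P(x_P,\hat u)\\ \hat f_C(x_P,x_C,\hat x_P,\hat u)-\frac{\partial g_C}{\partial x_C}(x_C,\hat x_P)f_C(x_C,\hat x_P)-\frac{\partial g_C}{\partial\hat x_P}(x_C,\hat x_P)\hat f_P(x_P,x_C,\hat x_P,\hat u)\end{pmatrix}.$$ Standing assumptions: $f_x$ and $f_e$ are continuous. The map $h_e:\mathbb{Z}_{\ge0}\times\mathbb{R}^{n_e}\to\mathbb{R}^{n_e}$ (the protocol) describes which part of the error is updated at a transmission; it is not assumed continuous. $\kappa$ is a counter of transmissions with values in $\mathbb{Z}_{\ge0}$. *)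

(* Defs.v *)
From HB Require Import structures.
From mathcomp Require Import all_boot all_order all_algebra.
From mathcomp Require Import all_classical all_reals all_analysis.

Set Implicit Arguments.
Unset Strict Implicit.
Unset Printing Implicit Defensive.

Import Order.TTheory GRing.Theory Num.Theory.
Import numFieldNormedType.Exports.

Local Open Scope classical_set_scope.
Local Open Scope ring_scope.

(* The library norm on 'rV[R]_n is the sup norm; [enorm] is the Euclidean one.
   Both induce the same topology and the same locally Lipschitz functions. *)
Definition enorm (R : realType) (n : nat) (v : 'rV[R]_n) : R :=
  Num.sqrt (\sum_(i < n) v 0 i ^+ 2).

Definition dist_set (R : realType) (n : nat) (A : set 'rV[R]_n)
    (q : 'rV[R]_n) : R :=
  inf [set enorm (q - p) | p in A].

(* Comparison functions are total functions on R of which only the values at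
   nonnegative arguments matter. *)

Definition class_K (R : realType) (alpha : R -> R) : Prop :=
  [/\ {within `[0, +oo[, continuous alpha},
      alpha 0 = 0 &
      forall s s', 0 <= s -> s < s' -> alpha s < alpha s'].

Definition class_Kinfty (R : realType) (alpha : R -> R) : Prop :=
  class_K alpha /\ forall M : R, exists2 s, 0 <= s & M < alpha s.

Definition class_KL (R : realType) (beta : R -> R -> R) : Prop :=
  [/\ {within [set p : R * R | 0 <= p.1 /\ 0 <= p.2],
         continuous (fun p : R * R => beta p.1 p.2)},
      forall t, 0 <= t -> class_K (beta ^~ t),
      forall s t t', 0 <= s -> 0 <= t -> t <= t' -> beta s t' <= beta s t &
      forall s, 0 <= s -> beta s t @[t --> +oo] --> (0 : R)].

Definition class_KLL (R : realType) (beta : R -> R -> R -> R) : Prop :=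
  forall r, 0 <= r ->
    class_KL (fun s t => beta s t r) /\ class_KL (fun s t => beta s r t).

Definition positive_definite (R : realType) (f : R -> R) : Prop :=
  f 0 = 0 /\ forall s, s != 0 -> 0 < f s.

(* [lipschitz_on] takes a filter on pairs: near (x, x) means that both
   arguments range over a neighborhood of x. *)
Definition locally_lipschitz (R : realType) (n : nat) (f : 'rV[R]_n -> R) :
    Prop :=
  forall x : 'rV[R]_n, lipschitz_on f (nbhs (x, x)).

(* Extended-real valued; finite when [U] is locally Lipschitz. *)
Definition clarke (R : realType) (n : nat) (U : 'rV[R]_n -> R)
    (z v : 'rV[R]_n) : \bar R :=
  limf_esup (fun p : 'rV[R]_n * R => ((U (p.1 + p.2 *: v) - U p.1) / p.2)%:E)
            (filter_prod (nbhs z) (at_right (0 : R))).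

Record hybrid_system (R : realType) (n : nat) := HybridSystem {
  flow_set : set 'rV[R]_n ;
  flow_map : 'rV[R]_n -> 'rV[R]_n ;
  jump_set : set 'rV[R]_n ;
  jump_map : 'rV[R]_n -> 'rV[R]_n }.

Definition compact_time_domain (R : realType) (E : set (R * nat)) : Prop :=
  exists (m : nat) (t : nat -> R),
    [/\ t 0%N = 0,
        forall j, (j < m)%N -> t j <= t j.+1 &
        E = [set p | (p.2 < m)%N /\ t p.2 <= p.1 <= t p.2.+1]].

Definition hybrid_time_domain (R : realType) (E : set (R * nat)) : Prop :=
  E `<=` [set p | 0 <= p.1] /\
  forall (T : R) (J : nat), E (T, J) ->
    compact_time_domain (E `&` [set p | 0 <= p.1 <= T /\ (p.2 <= J)%N]).

Definition time_slice (R : realType) (E : set (R * nat)) (j : nat) : set R :=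
  [set t | E (t, j)].

(* The intervals [u i, v i] are listed from left to right, without overlap. *)
Definition abs_continuous_on (R : realType) (n : nat) (a b : R)
    (f : R -> 'rV[R]_n) : Prop :=
  forall eps, 0 < eps -> exists2 delta, 0 < delta &
    forall (m : nat) (u v : nat -> R),
      (forall i, (i < m)%N -> a <= u i /\ u i <= v i /\ v i <= b) ->
      (forall i, (i.+1 < m)%N -> v i <= u i.+1) ->
      \sum_(i < m) (v i - u i) < delta ->
      \sum_(i < m) enorm (f (v i) - f (u i)) < eps.

Definition locally_abs_continuous_on (R : realType) (n : nat) (I : set R)
    (f : R -> 'rV[R]_n) : Prop :=
  forall a b, a <= b -> `[a, b] `<=` I -> abs_continuous_on a b f.

Definition hybrid_arc (R : realType) (n : nat) (dom : set (R * nat))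
    (phi : R -> nat -> 'rV[R]_n) : Prop :=
  hybrid_time_domain dom /\
  forall j, locally_abs_continuous_on (time_slice dom j) (phi ^~ j).

(* [phi] is only relevant on [dom].  Flow conditions are imposed on the
   interior of the time slices, hence void for slices reduced to a point. *)
Definition solution (R : realType) (n : nat) (S : hybrid_system R n)
    (dom : set (R * nat)) (phi : R -> nat -> 'rV[R]_n) : Prop :=
  [/\ hybrid_arc dom phi,
      dom (0, 0%N) /\ (flow_set S `|` jump_set S) (phi 0 0%N),
      forall j t, (time_slice dom j)° t -> flow_set S (phi t j),
      forall j, {ae lebesgue_measure, forall t : R,
        (time_slice dom j)° t ->
        is_derive t (1 : R) (phi ^~ j) (flow_map S (phi t j))} &
      forall t j, dom (t, j) -> dom (t, j.+1) ->
        jump_set S (phi t j) /\ phi t j.+1 = jump_map S (phi t j)].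

Definition S_GAS (R : realType) (n : nat) (S : hybrid_system R n)
    (A : set 'rV[R]_n) : Prop :=
  closed A /\
  forall Delta : R, 0 < Delta ->
    exists2 beta : R -> R -> R -> R, class_KLL beta &
      forall dom phi, solution S dom phi ->
        dist_set A (phi 0 0%N) < Delta ->
        forall t j, dom (t, j) ->
          dist_set A (phi t j) <= beta (dist_set A (phi 0 0%N)) t j%:R.

Definition semiglobal_dwell_time_outside (R : realType) (n : nat)
    (S : hybrid_system R n) (A : set 'rV[R]_n) : Prop :=
  forall Delta : R, 0 < Delta ->
    exists2 tau : R, 0 < tau &
      forall dom phi, solution S dom phi ->
        dist_set A (phi 0 0%N) < Delta ->
        forall s i t j, dom (s, i) -> dom (t, j) -> s <= t -> (i <= j)%N ->
          (forall t' j', dom (t', j') -> s <= t' <= t -> (i <= j' <= j)%N ->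
             ~ A (phi t' j')) ->
          j%:R - i%:R <= (t - s) / tau + 1.

(* The state is x = (x_P, x_C), the network-induced error is
   e = (e_{x_P}, e_u) = (xhat_P - x_P, uhat - u), where u = g_C(x_C, xhat_P). *)

Record networked_system (R : realType) (nP nC nu : nat) := NetworkedSystem {
  f_P : 'rV[R]_nP -> 'rV[R]_nu -> 'rV[R]_nP ;
  f_C : 'rV[R]_nC -> 'rV[R]_nP -> 'rV[R]_nC ;
  g_C : 'rV[R]_nC -> 'rV[R]_nP -> 'rV[R]_nu ;
  fhat_P : 'rV[R]_nP -> 'rV[R]_nC -> 'rV[R]_nP -> 'rV[R]_nu -> 'rV[R]_nP ;
  fhat_C : 'rV[R]_nP -> 'rV[R]_nC -> 'rV[R]_nP -> 'rV[R]_nu -> 'rV[R]_nu }.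

Definition f_x (R : realType) (nP nC nu : nat)
    (N : networked_system R nP nC nu)
    (x : 'rV[R]_(nP + nC)) (e : 'rV[R]_(nP + nu)) : 'rV[R]_(nP + nC) :=
  let xP := lsubmx x in
  let xC := rsubmx x in
  let xPhat := xP + lsubmx e in
  let uhat := g_C N xC xPhat + rsubmx e in
  row_mx (f_P N xP uhat) (f_C N xC xPhat).

(* The two differentials are the partial derivatives of g_C applied to the
   velocities of x_C and xhat_P.  They are meaningful when g_C is partially
   differentiable; ['d] is a total operator, so f_e is always defined. *)
Definition f_e (R : realType) (nP nC nu : nat)
    (N : networked_system R nP nC nu)
    (x : 'rV[R]_(nP + nC)) (e : 'rV[R]_(nP + nu)) : 'rV[R]_(nP + nu) :=
  let xP := lsubmx x in
  let xC := rsubmx x in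
  let xPhat := xP + lsubmx e in
  let uhat := g_C N xC xPhat + rsubmx e in
  row_mx
    (fhat_P N xP xC xPhat uhat - f_P N xP uhat)
    (fhat_C N xP xC xPhat uhat
     - 'd (fun z : 'rV[R]_nC => g_C N z xPhat) xC (f_C N xC xPhat)
     - 'd (fun z : 'rV[R]_nP => g_C N xC z) xPhat (fhat_P N xP xC xPhat uhat)).

(* The state of the hybrid model is q = (x, e, kappa, eta) in R^(nx + ne + 2).
   The counter kappa is a real coordinate; that it takes values in the
   nonnegative integers is part of [state_space]. *)

Definition mk_state (R : realType) (nx ne : nat) (x : 'rV[R]_nx)
    (e : 'rV[R]_ne) (kappa eta : R) : 'rV[R]_(nx + ne + 2) :=
  row_mx (row_mx x e) (\row_(i < 2) if i == 0 then kappa else eta).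

Definition q_x (R : realType) (nx ne : nat) (q : 'rV[R]_(nx + ne + 2)) :
  'rV[R]_nx := lsubmx (lsubmx q).
Definition q_e (R : realType) (nx ne : nat) (q : 'rV[R]_(nx + ne + 2)) :
  'rV[R]_ne := rsubmx (lsubmx q).
Definition q_kappa (R : realType) (nx ne : nat) (q : 'rV[R]_(nx + ne + 2)) :
  R := rsubmx q 0 0.
Definition q_eta (R : realType) (nx ne : nat) (q : 'rV[R]_(nx + ne + 2)) :
  R := rsubmx q 0 1.

Definition state_space (R : realType) (nx ne : nat) :
    set 'rV[R]_(nx + ne + 2) :=
  [set q | q_kappa q \is a Num.nat].

(* [Num.truncn] reads the counter of a point of [state_space] as a nat. *)
Definition ncs_hybrid (R : realType) (nP nC nu : nat)
    (N : networked_system R nP nC nu)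
    (h_e : nat -> 'rV[R]_(nP + nu) -> 'rV[R]_(nP + nu))
    (L G : 'rV[R]_(nP + nC) -> 'rV[R]_(nP + nu) -> R) (a rho : R) :
    hybrid_system R (nP + nC + (nP + nu) + 2) :=
  {| flow_set := @state_space R (nP + nC) (nP + nu) `&`
       [set q | q_eta q \in `[a * rho ^+ 2, a]] ;
     flow_map := fun q =>
       let x := q_x q in let e := q_e q in let eta := q_eta q in
       mk_state (f_x N x e) (f_e N x e) 0
                (- 2 * eta * L x e - eta ^+ 2 - G x e) ;
     jump_set := @state_space R (nP + nC) (nP + nu) `&`
       [set q | q_eta q = a * rho ^+ 2] ;
     jump_map := fun q =>
       mk_state (q_x q) (h_e (Num.truncn (q_kappa q)) (q_e q))
                (q_kappa q + 1) a |}.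

Definition ncs_attractor (R : realType) (nx ne : nat) :
    set 'rV[R]_(nx + ne + 2) :=
  @state_space R nx ne `&` [set q | q_x q = 0 /\ q_e q = 0].

(* Main.v *)
Require Import Defs.
From HB Require Import structures.
From mathcomp Require Import all_boot all_order all_algebra.
From mathcomp Require Import all_classical all_reals all_analysis.
From mathcomp Require Import measurable_realfun ring lra.
Set Implicit Arguments.
Unset Strict Implicit.
Unset Printing Implicit Defensive.
Import Order.TTheory GRing.Theory Num.Theory.
Import numFieldNormedType.Exports.
Local Open Scope classical_set_scope.
Local Open Scope ring_scope.

(** With U = V(x) + eta W(kappa, e)^2, the dynamics of eta are chosen so that U
    decreases along flows at rate at least varrho |x| + varrho |e| (complete the
    square H - eta W), while eta jumps from a rho^2 to a exactly as W^2 shrinks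
    by rho^2, so U does not increase at jumps.  Since the flow map is continuous,
    solutions are right differentiable at every flow time, and the Clarke bounds
    turn into bounds on the upper right Dini derivative of U.  On a sublevel set
    of U the functions L and G are bounded, so eta needs a minimal time to go from
    a to a rho^2: this is the dwell time, and it converts decay in t into decay
    in (t, j).  The decay itself is integrated without an ODE comparison: if the
    rate is at least m(U) with m nondecreasing, then U(t) + t m(U(t)) <= U(0). *)

(** * Dini derivatives of absolutely continuous functions *)

(** The flow equation is known only almost everywhere, while [V] and [W] are only locally Lipschitz,
    so no pointwise chain rule is at hand. The exceptional null set is therefore disposed of once,
    on the coordinates of the solution; afterwards every bound holds at each time of a half-open
    flow interval, and continuity is enough to integrate it. Boundedness of [(x, e)] has to precede
    every quantitative step: [varrho] may tend to [0] at infinity and [L], [G] may be unbounded, so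
    a decay rate and a dwell time exist only on a bounded set, chosen from [Delta]. This is the
    origin of the semiglobal character of both conclusions. The decay rate found there is monotone
    but possibly discontinuous, which makes a comparison equation driven by it an awkward tool. *)

Lemma near_right0P (R : realType) (P : set R) :
  (\forall h \near 0^'+, P h) <->
  exists2 d, 0 < d & forall h, 0 < h -> h < d -> P h.
Proof.
split=> [[d /= d0 Pd]|[d d0 Pd]].
  exists d => // h h0 hd; apply: Pd => //; rewrite /ball_/=.
  by rewrite sub0r normrN gtr0_norm.
by exists d => // h; rewrite /ball_/= sub0r normrN => hd h0; apply: Pd => //; rewrite -(gtr0_norm h0).
Qed.

(** The infimum of the counterexamples satisfies [P], being either [a] or a left limit of good
    points; the step to the right then leaves no counterexample just above it. *)
Lemma real_induction (R : realType) (P : R -> Prop) (a b : R) :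
  P a ->
  (forall t, a <= t < b -> P t ->
     exists2 d, 0 < d & forall s, t < s -> s < t + d -> s <= b -> P s) ->
  (forall t, a < t <= b -> (forall s, a <= s < t -> P s) -> P t) ->
  forall t, a <= t <= b -> P t.
Proof.
move=> Pa Pright Pleft t0 /andP[at0 t0b].
apply: contrapT => nPt0.
pose S := [set s | a <= s <= b /\ ~ P s].
have S0 : S !=set0 by exists t0; split=> //; rewrite at0.
have Slb : lbound S a by move=> s [/andP[]].
have hS : has_inf S by split=> //; exists a.
have aS : a <= inf S by apply: lb_le_inf.
have infb : inf S <= b.
  by apply: (le_trans _ t0b); apply: ge_inf; [exists a|split=> //; rewrite at0].
have below s : a <= s < inf S -> P s.
  move=> /andP[as_ sS]; apply: contrapT => nPs.
  have : inf S <= s.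
    apply: ge_inf; first by exists a.
    by split=> //; rewrite as_ (le_trans (ltW sS)).
  by rewrite leNgt sS.
have PS : P (inf S).
  move: aS; rewrite le_eqVlt => /predU1P[<- //|aS].
  by apply: Pleft => //; rewrite aS.
have Sb : inf S < b.
  rewrite lt_neqAle infb andbT; apply/eqP => eb.
  have : inf S <= t0 by apply: ge_inf; [exists a|split=> //; rewrite at0].
  by rewrite eb => bt0; apply: nPt0; rewrite (le_anti (_ : t0 <= b <= t0)) -?eb// eb bt0 t0b.
have [|d d0 Pd] := Pright _ _ PS; first by rewrite aS Sb.
have [s [/andP[as_ sb] nPs] sd] := inf_adherent d0 hS.
apply: nPs; have [sS|Ss] := ltP s (inf S); first by apply: below; rewrite as_.
move: Ss; rewrite le_eqVlt => /predU1P[<- //|Ss].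
exact: Pd.
Qed.

(** The upper right Dini derivative of [f] at [t] is at most [c]; multiplying out by [h] avoids a
    limsup of quotients in the extended reals. *)
Definition dini_le (R : realType) (f : R -> R) (t c : R) : Prop :=
  forall eps, 0 < eps ->
    \forall h \near 0^'+, f (t + h) - f t <= (c + eps) * h.

Lemma within_continuousRP (R : realType) (A : set R) (g : R -> R) :
  {within A, continuous g} <->
  forall x, A x -> forall eps, 0 < eps -> exists2 d, 0 < d &
    forall y, A y -> `|y - x| < d -> `|g y - g x| < eps.
Proof.
rewrite subspace_continuousP; split=> [cg x Ax eps eps0|cg x Ax].
  have /cvgrPdist_lt/(_ _ eps0) := cg _ Ax.
  rewrite /prop_near1/= /nbhs/= /within/= => /nbhs_ballP[d /= d0 dP].
  exists d => // y Ay yx; rewrite distrC; apply: dP => //.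
  by rewrite /ball/= distrC.
apply/cvgrPdist_lt => eps eps0; have [d d0 dP] := cg _ Ax _ eps0.
rewrite /prop_near1/= /nbhs/= /within/=; apply/nbhs_ballP; exists d => //= y yx Ay.
by rewrite distrC; apply: dP => //; rewrite distrC.
Qed.

(** Peel off the rightmost interval: taken half-open, it is disjoint from the part of [O] below
    [u m], and the induction hypothesis with [t := u m] accounts for the others there. The half-line
    in the bound is what lets the induction close. *)
Lemma sum_itv_le_measure (R : realType) (O : set R) (m : nat) (u v : nat -> R)
    (t : R) :
  open O ->
  (forall i, (i < m)%N -> u i <= v i /\ v i <= t /\ `[u i, v i] `<=` O) ->
  (forall i, (i.+1 < m)%N -> v i <= u i.+1) ->
  ((\sum_(i < m) (v i - u i))%:E <=
     @lebesgue_measure R (O `&` `]-oo, t[%classic))%E.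
Proof.
move=> oO; elim: m t => [|m IH] t uv vu; first by rewrite big_ord0 measure_ge0.
have [uvm [vmt uvO]] := uv m (ltnSn _).
rewrite big_ord_recr/= EFinD.
have mO : measurable O by exact: open_measurable.
have -> : (v m - u m)%:E = lebesgue_measure (`[u m, v m[%classic : set R).
  by rewrite lebesgue_measure_itv/= lte_fin; case: ltgtP uvm => // ->; rewrite subrr.
apply: (@le_trans _ _ (lebesgue_measure (O `&` `]-oo, u m[%classic) +
   lebesgue_measure (`[u m, v m[%classic : set R))%E).
  rewrite leeD2r//; apply: IH => i im; last by apply: vu; rewrite ltnS ltnW.
  have [? [? ?]] := uv i (ltnW im); split=> //; split=> //.
  have chain k : (i <= k)%N -> (k < m)%N -> v i <= v k.
    elim: k => [|k IHk]; first by rewrite leqn0 => /eqP->.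
    rewrite leq_eqVlt => /predU1P[->//|]; rewrite ltnS => ik km.
    rewrite (le_trans (IHk ik (ltnW km)))// (le_trans (vu k _))//; first exact: ltnW.
    by have [] := uv k.+1 (ltnW km).
  case: m => // m in uv vu uvm vmt uvO im chain *.
  by rewrite (le_trans (chain m _ _))// vu.
rewrite -measureU//; first 1 last.
- by apply: measurableI.
- apply/seteqP; split=> // x [[_ /=]]; rewrite !in_itv/= => xu /andP[].
  by rewrite leNgt xu.
apply: le_measure; rewrite ?inE.
- by apply: measurableU => //; apply: measurableI.
- by apply: measurableI.
- move=> x [[Ox] /=|/=]; rewrite ?in_itv/=.
    by move=> xu; split=> //; rewrite (lt_le_trans xu)// (le_trans uvm).
  move=> /andP[ux xv]; split; first by apply: uvO; rewrite /= in_itv/= ux ltW.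
  by rewrite (lt_le_trans xv).
Qed.

Lemma abs_continuous_within (R : realType) (n : nat) (f : R -> 'rV[R]_n)
    (a b : R) :
  abs_continuous_on a b f ->
  forall eps, 0 < eps -> exists2 d, 0 < d &
    forall s t, a <= s -> s <= t -> t <= b -> t - s < d ->
      enorm (f t - f s) < eps.
Proof.
move=> acf eps eps0; have [d d0 dP] := acf _ eps0.
exists d => // s t as_ st tb tsd.
have := dP 1%N (fun=> s) (fun=> t); rewrite !big_ord1; apply=> //.
Qed.

Lemma negligible_open_cover (R : realType) (N : set R) (d : R) :
  (@lebesgue_measure R).-negligible N -> 0 < d ->
  exists O : set R, [/\ open O, N `<=` O & (@lebesgue_measure R O < d%:E)%E].
Proof.
move=> [A [mA A0 NA]] d0.
have [|O [oO AO Od]] := @lebesgue_regularity_outer R A d mA _ d0.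
  by apply: (@le_lt_trans _ _ 0%E); [rewrite le_eqVlt; apply/orP; left; apply/eqP; exact: A0|exact: ltry].
exists O; split=> //; first exact: subset_trans AO.
rewrite -(setDUK AO) measureU//.
- apply: le_lt_trans Od; rewrite -[leRHS]add0e; apply: leeD => //.
  by rewrite le_eqVlt; apply/orP; left; apply/eqP; exact: A0.
- by apply: measurableD => //; exact: open_measurable.
- by rewrite setDE setICA setICr setI0.
Qed.

(* Outside an open set [O] of small measure the Dini bound pushes the estimate
   to the right; inside [O] the increments are absorbed by a finite family of
   intervals, whose total variation is small by absolute continuity. *)
Lemma abs_continuous_increment_le (R : realType) (n : nat) (f : R -> 'rV[R]_n)
    (g : R -> R) (a b c : R) :
  a <= b -> abs_continuous_on a b f ->
  (forall s t, `|g t - g s| <= enorm (f t - f s)) ->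
  {ae @lebesgue_measure R, forall t, a < t < b -> dini_le g t c} ->
  g b - g a <= c * (b - a).
Proof.
move=> ab acf gf aeg; apply/ler_addgt0Pr => e e0.
(* The final excess is [eps] per unit of length plus three further [eps]: the variation of [f] over
   the covering intervals, [K] times their length, and the slack [eta]. *)
pose eps := e / (b - a + 3); have ba3 : 0 < b - a + 3 by lra.
have eps0 : 0 < eps by rewrite divr_gt0.
pose K := `|c + eps|; have K0 : 0 <= K by exact: normr_ge0.
have cK : c + eps <= K by exact: ler_norm.
have cKN : - (c + eps) <= K by rewrite /K -normrN; exact: ler_norm.
have [d d0 dP] := acf _ eps0.
pose d' := Num.min d (eps / (K + 1)).
have d'0 : 0 < d' by rewrite lt_min d0/= divr_gt0//; lra.
(* The point [a] is counted among the bad points, because the Dini bound is available only for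
   [t > a]. *)
have cover : exists O : set R, [/\ open O,
    ~` [set t | t != a /\ (a < t < b -> dini_le g t c)] `<=` O &
    (@lebesgue_measure R O < d'%:E)%E].
  apply: negligible_open_cover => //.
  rewrite -/(almost_everywhere _ _); apply: filterI => //.
  exists [set a]; split; [exact: measurable_set1|exact: lebesgue_measure_set1|].
  by move=> x /=; apply: contra_notP => /eqP.
case: cover => O [oO NO Od].
have lenO m (u v : nat -> R) :
    (forall i, (i < m)%N -> u i <= v i /\ v i <= b /\ `[u i, v i] `<=` O) ->
    (forall i, (i.+1 < m)%N -> v i <= u i.+1) ->
    \sum_(i < m) (v i - u i) < d'.
  move=> uv vu; rewrite -lte_fin; apply: le_lt_trans Od.
  apply: le_trans (sum_itv_le_measure oO uv vu) _.
  apply: le_measure; rewrite ?inE; [|exact: open_measurable|by move=> x []].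
  by apply: measurableI => //; exact: open_measurable.
(* The slack [eta] is universally quantified so that left limits pass: for each [eta] the list of
   intervals of a nearby [s < t] is reused. The term in [K] pays for the change of
   [(c + eps) * (t - a)] across an interval when [c + eps] is negative. *)
pose P t := forall eta, 0 < eta -> exists (m : nat) (u v : nat -> R),
  [/\ forall i, (i < m)%N -> [/\ a <= u i, u i <= v i, v i <= t & `[u i, v i] `<=` O],
      forall i, (i.+1 < m)%N -> v i <= u i.+1 &
      g t - g a <= (c + eps) * (t - a) +
        \sum_(i < m) (enorm (f (v i) - f (u i)) + K * (v i - u i)) + eta].
have /(_ b) : forall t, a <= t <= b -> P t.
  apply: real_induction.
  - move=> eta eta0; exists 0%N, (fun=> a), (fun=> a); split=> //.
    by rewrite !subrr mulr0 big_ord0 !add0r ltW.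
  - move=> t /andP[at_ tb] Pt; have [Ot|nOt] := pselect (O t).
      have /near_right0P[r r0 rP] := open_itvoo_subset oO Ot.
      exists (r / 2); first by rewrite divr_gt0.
      move=> s ts sr sb eta eta0; have [m [u [v [uv vu gt]]]] := Pt _ eta0.
      pose u' i := if (i < m)%N then u i else t.
      pose v' i := if (i < m)%N then v i else s.
      exists m.+1, u', v'; split.
      + move=> i; rewrite /u' /v' ltnS leq_eqVlt => /predU1P[->|im].
          rewrite ltnn; split=> //; first exact: ltW.
          move=> x /=; rewrite in_itv/= => /andP[tx xs].
          apply: (rP (r / 2 + r / 4)); [lra|lra|].
          by rewrite /= in_itv/=; apply/andP; split; lra.
        rewrite im; have [? ? vt ?] := uv _ im; split=> //.
        by rewrite (le_trans vt)// ltW.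
      + move=> i; rewrite /u' /v' ltnS => im; rewrite im.
        case: ifPn => [|_]; first exact: vu.
        by have [] := uv _ im.
      + rewrite big_ord_recr/= /u' /v' ltnn.
        under eq_bigr => i _ do rewrite ltn_ord.
        have : g s - g t <= enorm (f s - f t) by rewrite (le_trans (ler_norm _)).
        have : - (c + eps) * (s - t) <= K * (s - t) by rewrite ler_wpM2r//; lra.
        by move: gt; lra.
    have [ta tdini] : t != a /\ (a < t < b -> dini_le g t c).
      by apply: contrapT => nt; apply: nOt; exact: NO.
    have : a < t < b by rewrite lt_neqAle eq_sym ta at_.
    move=> /tdini/(_ _ eps0)/near_right0P[r r0 rP].
    exists r => // s ts sr sb eta eta0.
    have [m [u [v [uv vu gt]]]] := Pt _ eta0.
    exists m, u, v; split=> //.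
      move=> i im; have [? ? vt ?] := uv _ im; split=> //.
      by rewrite (le_trans vt)// ltW.
    have := rP (s - t); rewrite (addrC t) subrK => /(_ _ _) gst.
    have : g s - g t <= (c + eps) * (s - t) by apply: gst; lra.
    by move: gt; lra.
  - move=> t /andP[at_ tb] Ps eta eta0.
    have eta3 : 0 < eta / 3 by rewrite divr_gt0.
    have [r r0 rP] := abs_continuous_within acf eta3.
    pose r' := Num.min (r / 2) (eta / 3 / (K + 1)).
    have r'0 : 0 < r' by rewrite lt_min !divr_gt0//; lra.
    pose s := Num.max a (t - r').
    have as_ : a <= s by rewrite le_max lexx.
    have st : s < t by rewrite gt_max at_/=; lra.
    have tsr' : t - s <= r' by rewrite lerBlDl -lerBlDr le_max lexx orbT.
    have tsr : t - s < r.
      by rewrite (le_lt_trans tsr')// gt_min; apply/orP; left; lra.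
    have Kts : K * (t - s) <= eta / 3.
      have : t - s <= eta / 3 / (K + 1).
        by rewrite (le_trans tsr')// ge_min lexx orbT.
      rewrite ler_pdivlMr; last lra.
      by apply: le_trans; rewrite mulrC ler_wpM2l//; lra.
    have [|m [u [v [uv vu gs]]]] := Ps s _ _ eta3; first by rewrite as_.
    exists m, u, v; split=> //.
      move=> i im; have [? ? vt ?] := uv _ im; split=> //.
      by rewrite (le_trans vt)// ltW.
    have gts : g t - g s <= eta / 3.
      by rewrite (le_trans (ler_norm _))// (le_trans (gf _ _))// ltW// rP// ltW.
    have : - (c + eps) * (t - s) <= K * (t - s) by rewrite ler_wpM2r//; lra.
    by move: gs; lra.
rewrite ab lexx => /(_ isT _ eps0)[m [u [v [uv vu gb]]]].
have len : \sum_(i < m) (v i - u i) < d'.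
  by apply: lenO => // i im; have [] := uv _ im.
have var : \sum_(i < m) enorm (f (v i) - f (u i)) < eps.
  apply: dP => //; first by move=> i im; have [] := uv _ im.
  by rewrite (lt_le_trans len)// ge_min lexx.
rewrite big_split/= -mulr_sumr in gb.
have Klen : K * \sum_(i < m) (v i - u i) <= eps.
  have : \sum_(i < m) (v i - u i) <= eps / (K + 1).
    by rewrite (le_trans (ltW len))// ge_min lexx orbT.
  rewrite ler_pdivlMr; last lra.
  apply: le_trans; rewrite mulrC ler_wpM2l//; last lra.
  by apply: sumr_ge0 => i _; have [] := uv _ (ltn_ord i); rewrite subr_ge0.
have : eps * (b - a + 3) = e by rewrite /eps divfK// gt_eqF.
by lra.
Qed.

(** * Coordinates, one-sided derivatives and continuity of arcs *)

Lemma enorm_ge0 (R : realType) (n : nat) (v : 'rV[R]_n) : 0 <= enorm v.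
Proof. exact: sqrtr_ge0. Qed.

Lemma coord_le_enorm (R : realType) (n : nat) (v : 'rV[R]_n) (i : 'I_n) :
  `|v 0 i| <= enorm v.
Proof.
rewrite -sqrtr_sqr ler_wsqrtr// (bigD1 i)//= lerDl.
by apply: sumr_ge0 => j _; exact: sqr_ge0.
Qed.

Lemma norm_mx_le (R : realType) (m n : nat) (v : 'M[R]_(m, n)) (r : R) :
  0 <= r -> (forall i j, `|v i j| <= r) -> `|v| <= r.
Proof.
move=> r0 vr; have [v0|/mx_norm_neq0[[i j] vij]] := eqVneq (mx_norm v) 0.
  by rewrite [`|v|]v0.
by rewrite [`|v|]vij; exact: vr.
Qed.

Lemma cvg_mx (R : realType) (T : Type) (m n : nat) (F : set_system T)
    {FF : Filter F} (f : T -> 'M[R]_(m, n)) (l : 'M[R]_(m, n)) :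
  (forall i j, f x i j @[x --> F] --> l i j) -> f x @[x --> F] --> l.
Proof.
move=> fl A [P /= lP PA].
have : \forall x \near F, forall i j, P i j (f x i j).
  apply: filter_forall => i; apply: filter_forall => j; exact: (fl i j) (lP i j).
by apply: filterS => x Px; exact: PA.
Qed.

Lemma is_derive_coord (R : realType) (n : nat) (f : R -> 'rV[R]_n) (t : R)
    (df : 'rV[R]_n) (i : 'I_n) :
  is_derive t (1 : R) f df -> forall eps, 0 < eps ->
  \forall h \near 0^'+, `|f (t + h) 0 i - f t 0 i - df 0 i * h| <= eps * h.
Proof.
move=> [df1 df2] eps eps0.
have : (h^-1 *: (f (h + t) - f t)) 0 i @[h --> (0 : R)^'] --> df 0 i.
  apply: (@continuous_cvg _ _ _ _ _ _ (fun M : 'rV[R]_n => M 0 i)).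
    exact: coord_continuous.
  rewrite -df2 /derive; apply: cvg_trans df1; apply: near_eq_cvg.
  by near=> h; rewrite /= /GRing.scale/= mulr1.
move=> /cvg_dnbhs_at_right/cvgrPdist_le/(_ _ eps0) H; near=> h.
have h0 : 0 < h by [].
have : `|df 0 i - (h^-1 *: (f (h + t) - f t)) 0 i| <= eps by near: h.
rewrite !mxE -(ler_pM2r h0) -[X in _ * X <= _](gtr0_norm h0) -normrM.
rewrite mulrBl mulrAC mulVf ?gt_eqF// mul1r distrC.
by rewrite (addrC t).
Unshelve. all: by end_near. Qed.

Lemma abs_le_dini_le (R : realType) (g : R -> R) (t c : R) :
  (forall eps, 0 < eps ->
    \forall h \near 0^'+, `|g (t + h) - g t - c * h| <= eps * h) ->
  dini_le g t c /\ dini_le (fun s => - g s) t (- c).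
Proof.
move=> gc; split=> eps /gc; apply: filterS => h; rewrite ler_norml; lra.
Qed.

Lemma dini_le_weaken (R : realType) (g : R -> R) (t c c' : R) :
  c <= c' -> dini_le g t c -> dini_le g t c'.
Proof.
move=> cc' gc eps eps0; near=> h.
have h0 : 0 < h by [].
have : g (t + h) - g t <= (c + eps) * h by near: h; exact: gc.
by move/le_trans; apply; rewrite ler_pM2r// lerD2r.
Unshelve. all: by end_near. Qed.

Lemma abs_continuous_onS (R : realType) (n : nat) (f : R -> 'rV[R]_n)
    (a b a' b' : R) :
  a <= a' -> b' <= b -> abs_continuous_on a b f -> abs_continuous_on a' b' f.
Proof.
move=> aa bb acf eps eps0; have [d d0 dP] := acf _ eps0.
exists d => // m u v uv vu; apply: dP => // i im.
have [? [? ?]] := uv _ im.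
by split; [exact: (le_trans aa)|split=> //; exact: (le_trans _ bb)].
Qed.

Lemma itv_interior (R : realType) (I : set R) (a b t : R) :
  `[a, b] `<=` I -> a < t < b -> I° t.
Proof.
move=> abI tab; apply: (@filterS _ _ _ `]a, b[%classic).
  by apply: subset_trans abI => x /=; apply: subset_itv_oo_cc.
by apply: near_in_itvoo; rewrite in_itv.
Qed.

Lemma abs_continuous_continuous (R : realType) (n : nat) (f : R -> 'rV[R]_n) (a b : R) :
  abs_continuous_on a b f -> {within `[a, b], continuous f}.
Proof.
move=> acf; apply/subspace_continuousP => t; rewrite /= in_itv/= => /andP[at_ tb].
apply: cvg_mx => i j; apply/cvgrPdist_lt => eps eps0.
have [d d0 dP] := abs_continuous_within acf eps0.
rewrite /prop_near1/= /nbhs/= /within/=; apply/nbhs_ballP; exists d => //= s ts.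
rewrite in_itv/= => /andP[as_ sb]; rewrite (ord1 i).
have coordB u v : `|f u 0 j - f v 0 j| <= enorm (f u - f v).
  by have := coord_le_enorm (f u - f v) j; rewrite !mxE.
have [st|/ltW ts'] := leP s t.
  apply: le_lt_trans (coordB _ _) _; apply: dP => //.
  by move: ts; rewrite /ball/= ger0_norm ?subr_ge0.
rewrite distrC; apply: le_lt_trans (coordB _ _) _; apply: dP => //.
by move: ts; rewrite /ball/= distrC ger0_norm ?subr_ge0.
Qed.

(** * Solutions of hybrid systems *)

(** Just to the right of [t] the velocity component stays within [eps / 2] of its value at [t]. The
    almost-everywhere increment bound on [[t, t + h]], applied to the coordinate and to its
    negative, then squeezes the increment from both sides. The left endpoint of a flow interval is
    included. *)
Lemma solution_right_derivative (R : realType) (n : nat)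
    (S : hybrid_system R n) (dom : set (R * nat)) (phi : R -> nat -> 'rV[R]_n)
    (j : nat) (a b t : R) (i : 'I_n) :
  solution S dom phi -> `[a, b] `<=` time_slice dom j -> a <= t < b ->
  continuous (fun q => flow_map S q 0 i) ->
  forall eps, 0 < eps -> \forall h \near 0^'+,
    `|phi (t + h) j 0 i - phi t j 0 i - flow_map S (phi t j) 0 i * h|
      <= eps * h.
Proof.
move=> [[_ ac] _ _ aed _] abI /andP[at_ tb] cF eps eps0.
have ab : a <= b by rewrite (le_trans at_)// ltW.
have {}ac := ac j _ _ ab abI.
have e2 : 0 < eps / 2 by rewrite divr_gt0.
have cFphi : {within `[a, b], continuous (fun s => flow_map S (phi s j) 0 i)}.
  apply/subspace_continuousP => s sab.
  have /subspace_continuousP/(_ _ sab) := abs_continuous_continuous ac.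
  exact: (continuous_cvg _ (cF (phi s j))).
move/within_continuousRP : cFphi => /(_ t).
rewrite /= in_itv/= at_ (ltW tb) => /(_ isT _ e2)[d d0 dP].
apply/near_right0P; exists (Num.min d (b - t)).
  by rewrite lt_min d0 subr_gt0.
move=> h h0; rewrite lt_min ltrBrDl => /andP[hd hb].
have tth : t <= t + h by rewrite lerDl ltW.
have acth := abs_continuous_onS at_ (ltW hb) ac.
have coordB u v : `|phi v j 0 i - phi u j 0 i| <= enorm (phi v j - phi u j).
  by have := coord_le_enorm (phi v j - phi u j) i; rewrite !mxE.
pose c := flow_map S (phi t j) 0 i.
have dini s : t < s < t + h ->
    is_derive s (1 : R) (phi ^~ j) (flow_map S (phi s j)) ->
    dini_le (fun s => phi s j 0 i) s (c + eps / 2) /\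
    dini_le (fun s => - phi s j 0 i) s (- c + eps / 2).
  move=> /andP[ts sth] phis.
  have [H1 H2] := abs_le_dini_le (g := fun s => phi s j 0 i) (is_derive_coord i phis).
  have : `|flow_map S (phi s j) 0 i - flow_map S (phi t j) 0 i| < eps / 2.
    apply: dP; last by rewrite gtr0_norm ?subr_gt0//; lra.
    by rewrite in_itv/=; apply/andP; split; lra.
  rewrite ltr_norml -/c => /andP[? ?].
  by split; [apply: dini_le_weaken H1|apply: dini_le_weaken H2]; lra.
have aed' : {ae @lebesgue_measure R, forall s, t < s < t + h ->
    is_derive s (1 : R) (phi ^~ j) (flow_map S (phi s j))}.
  move: (aed j); apply: (@filterS _ _ (ae_filter_ringOfSetsType _)) => s H /andP[ts sth]; apply: H.
  by apply: itv_interior abI _; apply/andP; split; lra.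
have H1 : phi (t + h) j 0 i - phi t j 0 i <= (c + eps / 2) * (t + h - t).
  apply: (abs_continuous_increment_le (g := fun s => phi s j 0 i) tth acth) => //.
  by move: aed'; apply: (@filterS _ _ (ae_filter_ringOfSetsType _)) => s H tsh; have [] := dini _ tsh (H tsh).
have H2 : - phi (t + h) j 0 i - - phi t j 0 i <= (- c + eps / 2) * (t + h - t).
  apply: (abs_continuous_increment_le (g := fun s => - phi s j 0 i) tth acth).
    by move=> u v; rewrite -opprB normrN opprK addrC.
  by move: aed'; apply: (@filterS _ _ (ae_filter_ringOfSetsType _)) => s H tsh; have [] := dini _ tsh (H tsh).
have := mulr_gt0 eps0 h0.
rewrite -/c ler_norml; lra.
Qed.

(** The truncated domain comes with some number [m] of intervals. Membership of [(T, J)] forces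
    [J < m], and [J.+1 < m] would put a point with counter [J.+1] in a set where counters are at
    most [J]. Hence [m = J.+1], and the last grid time is [T]. *)
Lemma hybrid_time_domain_grid (R : realType) (dom : set (R * nat)) (T : R)
    (J : nat) :
  hybrid_time_domain dom -> dom (T, J) ->
  exists t : nat -> R,
    [/\ t 0%N = 0, t J.+1 = T,
        forall k, (k <= J)%N -> t k <= t k.+1 &
        forall k s, (k <= J)%N -> 0 <= s <= T ->
          dom (s, k) <-> t k <= s <= t k.+1].
Proof.
move=> [dom0 domc] domTJ; have [m [t [t0 tS E]]] := domc _ _ domTJ.
have T0 : 0 <= T by have := dom0 _ domTJ.
have Em s k : (dom (s, k) /\ (0 <= s <= T /\ (k <= J)%N)) <->
    ((k < m)%N /\ t k <= s <= t k.+1).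
  by have /(congr1 (fun A => A (s, k)))/= := E; rewrite propeqE.
have [Jm /andP[tJ TJ]] : (J < m)%N /\ t J <= T <= t J.+1.
  by apply/Em; split=> //; rewrite T0 lexx.
have mJ : m = J.+1.
  apply/eqP; rewrite eqn_leq Jm andbT leqNgt; apply/negP => mJ.
  have [_ [_]] : dom (t J.+1, J.+1) /\ (0 <= t J.+1 <= T /\ (J.+1 <= J)%N).
    by apply/Em; split=> //; rewrite lexx tS.
  by rewrite ltnn.
exists t; split=> //.
- have [_ [/andP[_ tT] _]] : dom (t J.+1, J) /\ (0 <= t J.+1 <= T /\ (J <= J)%N).
    by apply/Em; split=> //; rewrite lexx tS.
  by apply/eqP; rewrite eq_le tT TJ.
- by move=> k kJ; apply: tS; rewrite mJ.
- move=> k s kJ sT; split=> [domsk|tk].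
    by have [] := (Em s k).1 (conj domsk (conj sT kJ)).
  by have /Em[] : (k < m)%N /\ t k <= s <= t k.+1 by rewrite mJ ltnS.
Qed.

(** Between the two points the domain is a finite alternation of flow intervals and jumps, so one
    can induct on the number of jumps since [(s, i)]. Each invariant of solutions below is
    propagated in this way; the flow case receives a whole interval, as integrated estimates
    require. *)
Lemma hybrid_induction (R : realType) (dom : set (R * nat))
    (P : R -> nat -> Prop) (s : R) (i : nat) (t : R) (j : nat) :
  hybrid_time_domain dom -> dom (s, i) -> dom (t, j) -> s <= t -> (i <= j)%N ->
  P s i ->
  (forall a b k, a <= b -> `[a, b] `<=` time_slice dom k -> P a k -> P b k) ->
  (forall r k, dom (r, k) -> dom (r, k.+1) -> P r k -> P r k.+1) ->
  P t j.
Proof.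
move=> hd domsi domtj st ij Psi Pflow Pjump.
have s0 : 0 <= s by have := hd.1 _ domsi.
have [T [T0 Tj TS domT]] := hybrid_time_domain_grid hd domtj.
have Tmono k l : (k <= l)%N -> (l <= j.+1)%N -> T k <= T l.
  elim: l => [|l IH]; first by rewrite leqn0 => /eqP ->.
  rewrite leq_eqVlt => /predU1P[->//|]; rewrite ltnS => kl lj.
  by rewrite (le_trans (IH kl (ltnW lj)))// TS.
have slice k a b : (k <= j)%N -> T k <= a -> b <= T k.+1 ->
    `[a, b] `<=` time_slice dom k.
  move=> kj Ta bT r; rewrite /= in_itv/= => /andP[ar rb].
  have Tkr : T k <= r <= T k.+1 by rewrite (le_trans Ta)// (le_trans rb).
  apply/domT => //; move: Tkr => /andP[Tr rT].
  by rewrite -Tj (le_trans rT) ?Tmono// andbT -T0 (le_trans _ Tr)// Tmono// ltnW.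
have /andP[Tis siT] : T i <= s <= T i.+1 by apply/domT => //; rewrite s0.
suff : forall d r, (i + d <= j)%N -> T (i + d)%N <= r <= T (i + d).+1 -> s <= r ->
    P r (i + d)%N.
  move=> /(_ (j - i)%N t); rewrite subnKC//; apply=> //.
  by apply/domT => //; rewrite (le_trans s0) ?lexx.
elim=> [|d IH] r; rewrite ?addn0 ?addnS => dj /andP[Tr rT] sr.
  by apply: (Pflow s) => //; exact: slice.
have jd : (i + d <= j)%N by exact: ltnW.
have Td0 : 0 <= T (i + d).+1 by rewrite -T0 Tmono// ltnW.
have Tdt : T (i + d).+1 <= t by rewrite -Tj Tmono// ltnW.
apply: (Pflow (T (i + d).+1)) => //; first exact: slice.
apply: Pjump.
- by apply/domT => //; rewrite ?Td0// lexx TS.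
- by apply/domT => //; rewrite ?Td0// lexx TS.
- apply: IH => //; first by rewrite lexx TS.
  by rewrite (le_trans siT)// Tmono// ltnS ?leq_addr// ltnW.
Qed.

(** * Clarke and Dini derivatives *)

Lemma locally_lipschitz_near (R : realType) (n : nat) (U : 'rV[R]_n -> R)
    (x : 'rV[R]_n) :
  locally_lipschitz U -> exists M r : R, [/\ 0 < M, 0 < r &
    forall y z, `|y - x| < r -> `|z - x| < r ->
      `|U y - U z| <= M * `|y - z|].
Proof.
move=> /(_ x) [M0 [_ MP]].
have [|[A B]/= [nA nB] AB] := MP (Num.max M0 0 + 1).
  by rewrite ltr_pwDr// le_max lexx.
have [r r0 rA] := (nbhs_normP _ _).1 nA; have [r' r'0 rB] := (nbhs_normP _ _).1 nB.
exists (Num.max M0 0 + 1), (Num.min r r'); split.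
- by rewrite ltr_wpDl// le_max lexx orbT.
- by rewrite lt_min; apply/andP; split.
move=> y z; rewrite !lt_min => /andP[yr _] /andP[_ zr'].
apply: (AB (y, z)); split; [apply: rA|apply: rB] => /=.
  by rewrite /ball_/= distrC.
by rewrite /ball_/= distrC.
Qed.

(** On the straight line [phi t + h *: v] the difference quotient is among those of the Clarke
    limsup, with base point kept at [phi t]. The arc leaves this line by [o(h)], which the local
    Lipschitz constant [M] turns into an error of at most [eps / 2 * h]. *)
Lemma clarke_dini_le (R : realType) (n : nat) (U : 'rV[R]_n -> R)
    (phi : R -> 'rV[R]_n) (t : R) (v : 'rV[R]_n) (c : R) :
  locally_lipschitz U -> (clarke U (phi t) v <= c%:E)%E ->
  (forall i eps, 0 < eps -> \forall h \near 0^'+,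
     `|phi (t + h) 0 i - phi t 0 i - v 0 i * h| <= eps * h) ->
  dini_le (fun s => U (phi s)) t c.
Proof.
move=> Ulip Uc dphi eps eps0.
have e2 : 0 < eps / 2 by rewrite divr_gt0.
have : (clarke U (phi t) v < (c + eps / 2)%:E)%E.
  by rewrite (le_lt_trans Uc)// lte_fin ltrDl.
move=> /ereal_inf_lt[_ [A [[P Q] /= [nP nQ] PQA] <-]] supA.
have [M [r [M0 r0 lipU]]] := locally_lipschitz_near (phi t) Ulip.
have [d d0 Md] : exists2 d, 0 < d & M * d = eps / 2.
  by exists (eps / 2 / M); rewrite ?divr_gt0// mulrC divfK ?gt_eqF.
have dphi_norm : \forall h \near 0^'+, `|phi (t + h) - (phi t + h *: v)| <= d * h.
  have : \forall h \near 0^'+, forall i, `|phi (t + h) 0 i - phi t 0 i - v 0 i * h| <= d * h.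
    by apply: filter_forall => i; exact: dphi.
  move=> H; near=> h; have h0 : 0 < h by [].
  apply: norm_mx_le; first by rewrite mulr_ge0 ?ltW.
  move=> i j; rewrite (ord1 i) !mxE opprD addrA (mulrC h).
  by move: j; near: h.
have [N N0 hvN] : exists2 N, 0 <= N & forall h, 0 < h -> `|h *: v| = h * N.
  by exists `|v| => // h h0; rewrite normrZ gtr0_norm.
have K0 : 0 < N + d + 1 by lra.
near=> h; have h0 : 0 < h by [].
(* This keeps both the point of the line, at distance [h * N], and the point of the arc, at distance
   at most [h * (N + d)], in the ball where [U] is Lipschitz. *)
have hr : h < r / (N + d + 1) by near: h; apply: nbhs_right_lt; rewrite divr_gt0.
rewrite ltr_pdivlMr// in hr.
have hphi : `|phi (t + h) - (phi t + h *: v)| <= d * h by near: h.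
have hv := hvN _ h0.
have hd0 : 0 < d * h by rewrite mulr_gt0.
have near1 : `|(phi t + h *: v) - phi t| < r.
  rewrite addrC addKr hv; lra.
have near2 : `|phi (t + h) - phi t| < r.
  have -> : phi (t + h) - phi t = (phi (t + h) - (phi t + h *: v)) + h *: v.
    by rewrite opprD addrA subrK.
  by rewrite (le_lt_trans (ler_normD _ _))// hv; lra.
have := lipU _ _ near2 near1.
have : M * `|phi (t + h) - (phi t + h *: v)| <= eps / 2 * h.
  by rewrite -Md -mulrA ler_wpM2l// ltW.
have : (U (phi t + h *: v) - U (phi t)) / h < c + eps / 2.
  rewrite -lte_fin; apply: le_lt_trans supA; apply: ereal_sup_ubound.
  exists (phi t, h) => //; apply: PQA; split=> /=; first exact: nbhs_singleton.
  by near: h.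
rewrite ltr_pdivrMr// ler_norml; lra.
Unshelve. all: by end_near. Qed.

Lemma locally_lipschitz_continuous (R : realType) (n : nat) (U : 'rV[R]_n -> R) :
  locally_lipschitz U -> continuous U.
Proof.
move=> Ulip x; have [M [r [M0 r0 UM]]] := locally_lipschitz_near x Ulip.
apply/(@cvgrPdist_lt _ _ _ (nbhs x) (nbhs_filter x)) => eps eps0.
have rM : 0 < Num.min r (eps / M) by rewrite lt_min r0 divr_gt0.
have := nbhsx_ballx x _ rM; rewrite -ball_normE.
apply: (@filterS _ (nbhs x)) => y; rewrite /ball_/= lt_min => /andP[yr ye].
rewrite (le_lt_trans (UM _ _ _ _))//; first by rewrite subrr normr0.
  by rewrite distrC.
by rewrite mulrC -ltr_pdivlMr.
Qed.

Lemma dini_le_add (R : realType) (f g : R -> R) (t c d : R) :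
  dini_le f t c -> dini_le g t d -> dini_le (fun s => f s + g s) t (c + d).
Proof.
move=> fc gd eps eps0; have e2 : 0 < eps / 2 by rewrite divr_gt0.
near=> h.
have : f (t + h) - f t <= (c + eps / 2) * h by near: h; exact: fc.
have : g (t + h) - g t <= (d + eps / 2) * h by near: h; exact: gd.
lra.
Unshelve. all: by end_near. Qed.

(** The increment splits as [(eta(t+h) - eta(t)) w(t+h)^2 + eta(t) (w(t+h) + w(t)) (w(t+h) - w(t))].
    Only upper bounds on the increments are known, so their factors must be nonnegative: hence the
    sign conditions. *)
Lemma dini_le_mul_sqr (R : realType) (eta w : R -> R) (t c d : R) :
  0 <= eta t -> (forall s, 0 <= w s) -> w (t + h) @[h --> 0^'+] --> w t ->
  dini_le eta t c -> dini_le w t d ->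
  dini_le (fun s => eta s * w s ^+ 2) t (c * w t ^+ 2 + 2 * eta t * w t * d).
Proof.
move=> eta0 w0 cw etac wd eps eps0.
have w2 : 0 <= w t ^+ 2 by exact: sqr_ge0.
have ew : 0 <= eta t * w t by rewrite mulr_ge0.
have q0 : 0 < w t ^+ 2 + 2 * (eta t * w t) + 1 by lra.
have [r r0 rq] : exists2 r, 0 < r & r * (w t ^+ 2 + 2 * (eta t * w t) + 1) < eps.
  exists (eps / 2 / (w t ^+ 2 + 2 * (eta t * w t) + 1)); first by rewrite !divr_gt0.
  rewrite divfK ?gt_eqF//; lra.
(* [F (w (t + h))] bounds the difference quotient; [r] is so small that [F (w t)] is strictly below
   the target, and continuity of [F] does the rest. *)
pose F x := (c + r) * x ^+ 2 + eta t * (x + w t) * (d + r).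
have cF : F (w (t + h)) @[h --> 0^'+] --> F (w t).
  apply: (@continuous_cvg _ _ _ _ _ _ F) cw; rewrite /F => {}x.
  apply: cvgD; first by apply: cvgMr; exact: exprn_continuous.
  by apply: cvgMl; apply: cvgMr; apply: cvgD; [exact: cvg_id|exact: cvg_cst].
have Flt : F (w t) < c * w t ^+ 2 + 2 * eta t * w t * d + eps by rewrite /F; lra.
near=> h; have h0 : 0 < h by [].
have Fh : F (w (t + h)) < c * w t ^+ 2 + 2 * eta t * w t * d + eps.
  by near: h; move/cvgr_lt : cF; apply.
have /(ler_wpM2r (sqr_ge0 (w (t + h)))) : eta (t + h) - eta t <= (c + r) * h.
  by near: h; exact: etac.
have ew' : 0 <= eta t * (w (t + h) + w t) by rewrite mulr_ge0// addr_ge0.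
have /(ler_wpM2l ew') : w (t + h) - w t <= (d + r) * h by near: h; exact: wd.
have := ler_wpM2r (ltW h0) (ltW Fh).
rewrite /F; lra.
Unshelve. all: by end_near. Qed.

(** Without an exceptional null set, continuity takes the place of absolute continuity: real
    induction on the bound with slope [c + eps]. This version is the one that integrates the
    estimates on [kappa], [eta] and the Lyapunov function. *)
Lemma dini_increment_le (R : realType) (g : R -> R) (a b c : R) :
  a <= b -> {within `[a, b], continuous g} ->
  (forall t, a <= t < b -> dini_le g t c) -> g b - g a <= c * (b - a).
Proof.
move=> ab /within_continuousRP cg gc; apply/ler_addgt0Pr => e e0.
pose eps := e / (b - a + 1); have ba1 : 0 < b - a + 1 by lra.
have eps0 : 0 < eps by rewrite divr_gt0.
have epse : eps * (b - a + 1) = e by rewrite /eps divfK// gt_eqF.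
suff /(_ b) : forall t, a <= t <= b -> g t - g a <= (c + eps) * (t - a).
  by rewrite ab lexx => /(_ isT); lra.
apply: real_induction; first by rewrite !subrr mulr0.
  move=> t atb gt; have /near_right0P[d d0 dP] := gc _ atb _ eps0.
  exists d => // s ts sd sb; have := dP (s - t).
  rewrite (addrC t) subrK => H; have : g s - g t <= (c + eps) * (s - t).
    by apply: H; lra.
  by lra.
move=> t /andP[at_ tb] gs; apply/ler_addgt0Pr => r r0.
have r2 : 0 < r / 2 by rewrite divr_gt0.
have [|d d0 dP] := cg t _ _ r2; first by rewrite /= in_itv/= (ltW at_).
have K0 := normr_ge0 (c + eps).
have cK : - (c + eps) <= `|c + eps| by rewrite -normrN ler_norm.
pose r' := Num.min (d / 2) (r / 2 / (`|c + eps| + 1)).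
have r'0 : 0 < r' by rewrite lt_min !divr_gt0//; lra.
pose s := Num.max a (t - r').
have as_ : a <= s by rewrite le_max lexx.
have st : s < t by rewrite gt_max at_/=; lra.
have tsr' : t - s <= r' by rewrite lerBlDl -lerBlDr le_max lexx orbT.
have tsd : t - s < d.
  by rewrite (le_lt_trans tsr')// gt_min; apply/orP; left; lra.
have Kts : `|c + eps| * (t - s) <= r / 2.
  have : t - s <= r / 2 / (`|c + eps| + 1).
    by rewrite (le_trans tsr')// ge_min lexx orbT.
  rewrite ler_pdivlMr; last lra.
  by apply: le_trans; rewrite mulrC ler_wpM2l//; lra.
have : - (c + eps) * (t - s) <= `|c + eps| * (t - s) by rewrite ler_wpM2r//; lra.
have : `|g s - g t| < r / 2.
  apply: dP; last by rewrite distrC ger0_norm//; lra.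
  by rewrite /= in_itv/= as_/=; lra.
have : g s - g a <= (c + eps) * (s - a) by apply: gs; rewrite as_.
rewrite ltr_norml; lra.
Qed.

(** * Comparison functions *)

Lemma class_K_le (R : realType) (alpha : R -> R) (s s' : R) :
  class_K alpha -> 0 <= s -> s <= s' -> alpha s <= alpha s'.
Proof.
move=> [_ _ mono] s0; rewrite le_eqVlt => /predU1P[->//|ss'].
exact/ltW/mono.
Qed.

Lemma class_K_ge0 (R : realType) (alpha : R -> R) (s : R) :
  class_K alpha -> 0 <= s -> 0 <= alpha s.
Proof. by move=> aK s0; have [_ <- _] := aK; exact: class_K_le. Qed.

Lemma class_K_lt_inv (R : realType) (alpha : R -> R) (s s' : R) :
  class_K alpha -> 0 <= s' -> alpha s < alpha s' -> s < s'.
Proof.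
move=> aK s'0 ss'; rewrite ltNge; apply: contraTN ss' => s's.
by rewrite -leNgt class_K_le.
Qed.

Lemma class_K_le_inv (R : realType) (alpha : R -> R) (s s' : R) :
  class_K alpha -> 0 <= s' -> alpha s <= alpha s' -> s <= s'.
Proof.
move=> [_ _ mono] s'0 ss'; rewrite leNgt; apply/negP => /(mono _ _ s'0).
by rewrite ltNge ss'.
Qed.

Lemma within_continuous_comp (T S U : topologicalType) (A : set T) (B : set S)
    (f : T -> S) (g : S -> U) :
  {within A, continuous f} -> (forall x, A x -> B (f x)) ->
  {within B, continuous g} -> {within A, continuous (g \o f)}.
Proof.
move=> /subspace_continuousP cf AB /subspace_continuousP cg.
apply/subspace_continuousP => x Ax W /(cg _ (AB _ Ax)).
move=> /(cf _ Ax); rewrite /nbhs/= /within/=; apply: filterS => y yW Ay.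
by apply: yW => //; exact: AB.
Qed.

Lemma class_K_add (R : realType) (f g : R -> R) :
  class_K f -> class_K g -> class_K (fun s => f s + g s).
Proof.
move=> [cf f0 fm] [cg g0 gm]; split.
- by move=> x; apply: cvgD; [exact: cf|exact: cg].
- by rewrite f0 g0 addr0.
- by move=> s s' s0 ss'; rewrite ltrD// ?fm ?gm.
Qed.

Lemma class_K_scale (R : realType) (c : R) (f : R -> R) :
  0 < c -> class_K f -> class_K (fun s => c * f s).
Proof.
move=> c0 [cf f0 fm]; split.
- by move=> x; apply: cvgMr; exact: cf.
- by rewrite f0 mulr0.
- by move=> s s' s0 ss'; rewrite ltr_pM2l// fm.
Qed.

Lemma class_K_sqr (R : realType) (f : R -> R) :
  class_K f -> class_K (fun s => f s ^+ 2).
Proof.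
move=> fK; have [cf f0 fm] := fK; split.
- by move=> x; apply: cvgM; exact: cf.
- by rewrite f0 expr0n.
- move=> s s' s0 ss'; rewrite ltr_sqr ?nnegrE ?class_K_ge0//.
    exact: fm.
  by rewrite (le_trans s0)// ltW.
Qed.

Lemma class_Kinfty_scale (R : realType) (c : R) (f : R -> R) :
  0 < c -> class_Kinfty f -> class_Kinfty (fun s => c * f s).
Proof.
move=> c0 [fK fu]; split; first exact: class_K_scale.
move=> M; have [s s0 sM] := fu (M / c); exists s => //.
by rewrite mulrC -ltr_pdivrMr.
Qed.

Lemma class_Kinfty_sqr (R : realType) (f : R -> R) :
  class_Kinfty f -> class_Kinfty (fun s => f s ^+ 2).
Proof.
move=> [fK fu]; split; first exact: class_K_sqr.
move=> M; have [s s0] := fu (Num.max M 1); rewrite gt_max => /andP[sM s1].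
exists s => //; rewrite (lt_le_trans sM)// expr2 ler_peMl ?ltW//.
by rewrite (lt_trans _ s1).
Qed.

Lemma class_Kinfty_min (R : realType) (f g : R -> R) :
  class_Kinfty f -> class_Kinfty g -> class_Kinfty (fun s => Num.min (f s) (g s)).
Proof.
move=> [fK fu] [gK gu]; have [cf f0 fm] := fK; have [cg g0 gm] := gK.
split; first split.
- apply/within_continuousRP => x x0 eps eps0.
  have [d d0 df] := (within_continuousRP _ _).1 cf _ x0 _ eps0.
  have [r r0 rg] := (within_continuousRP _ _).1 cg _ x0 _ eps0.
  exists (Num.min d r); first by rewrite lt_min d0.
  move=> y y0; rewrite lt_min => /andP[/(df _ y0) + /(rg _ y0)].
  rewrite !ltr_norml => /andP[f1 f2] /andP[g1 g2]; rewrite /Num.min.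
  by case: (ltP (f x)) => fgx; case: (ltP (f y)) => fgy; apply/andP; split; lra.
- by rewrite f0 g0 minxx.
- by move=> s s' s0 ss'; rewrite lt_min !gt_min fm//= gm// orbT.
- move=> M; have [s s0 sM] := fu M; have [t t0 tM] := gu M.
  exists (Num.max s t); first by rewrite le_max s0.
  rewrite lt_min (lt_le_trans sM) ?(lt_le_trans tM)//; apply: class_K_le => //.
    by rewrite le_max lexx orbT.
  by rewrite le_max lexx.
Qed.

Lemma class_Kinfty_inverse (R : realType) (alpha : R -> R) :
  class_Kinfty alpha -> exists2 ainv : R -> R, class_K ainv &
    forall z, 0 <= z -> ainv (alpha z) = z.
Proof.
move=> [aK au]; have [ca a0 am] := aK.
(* The condition on [y] sits under the existential so that choice yields a total function, arbitrary
   at negative arguments. *)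
have ex y : exists z, 0 <= y -> 0 <= z /\ alpha z = y.
  have [y0|] := leP 0 y; last by exists 0.
  have [s s0 ys] := au y.
  have [|||z] := @IVT _ alpha 0 s y => //.
  - apply: continuous_subspaceW ca => x /=; rewrite !in_itv/= => /andP[-> _] //.
  - by rewrite a0 min_l ?max_r ?class_K_ge0// y0 ltW.
  by rewrite in_itv/= => /andP[z0 _] az; exists z.
have [ainv aP] := choice ex.
have ainvK z : 0 <= z -> ainv (alpha z) = z.
  move=> z0; have [w0 aw] := aP _ (class_K_ge0 aK z0).
  by apply/le_anti/andP; split; apply: (class_K_le_inv aK) => //; rewrite aw.
exists ainv => //; split.
- apply/within_continuousRP => y; rewrite /= in_itv/= andbT => y0 eps eps0.
  have [z0 az] := aP _ y0; set z := ainv y in z0 az *.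
  have zeps : alpha z < alpha (z + eps) by apply: am => //; rewrite ltrDl.
  (* If [z - eps] is negative, the lower estimate on [w] is automatic and [1] is an arbitrary
     positive radius. Otherwise the radius is read off [alpha], whose strict monotonicity controls
     its inverse. *)
  pose l := if z - eps < 0 then 1 else alpha z - alpha (z - eps).
  have l0 : 0 < l.
    rewrite /l; case: (ltP (z - eps) 0) => // ze; rewrite subr_gt0 am//.
    by rewrite ltrBlDl ltrDr.
  exists (Num.min l (alpha (z + eps) - alpha z)).
    by rewrite lt_min l0 subr_gt0.
  move=> x; rewrite in_itv/= andbT lt_min => x0 /andP[xl xu].
  have [w0 aw] := aP _ x0; set w := ainv x in w0 aw *.
  have wu : w < z + eps.
    apply: (class_K_lt_inv aK); first by rewrite addr_ge0// ltW.
    by rewrite aw; move: xu; rewrite ltr_norml -az; lra.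
  have wl : z - eps < w.
    move: xl; rewrite /l; case: (ltP (z - eps) 0) => [ze _|ze xl]; first by rewrite (lt_le_trans ze).
    apply: (class_K_lt_inv aK) => //.
    by rewrite aw; move: xl; rewrite ltr_norml -az; lra.
  by rewrite ltr_norml; lra.
- by have := ainvK 0 (lexx _); rewrite a0.
- move=> s s' s0 ss'; have s'0 : 0 <= s' by rewrite (le_trans s0)// ltW.
  have [z0 az] := aP _ s0; have [z'0 az'] := aP _ s'0.
  by apply: (class_K_lt_inv aK) => //; rewrite az az'.
Qed.

(** [varrho] need not be monotone, so it is replaced by its infimum over the [z] of [[0, D]] with
    [alpha z] at least [r]. This set shrinks as [r] grows, which gives monotonicity; for [r > 0] it
    stays away from [0], and compactness gives a positive minimum. *)
Lemma decay_rate (R : realType) (alpha varrho : R -> R) (D : R) :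
  class_K alpha -> continuous varrho -> positive_definite varrho -> 0 < D ->
  exists m : R -> R,
    [/\ m 0 = 0, {homo m : r r' / r <= r'}, forall r : R, 0 < r -> 0 < m r &
        forall z r, 0 <= z <= D -> r <= alpha z -> m r <= varrho z].
Proof.
move=> aK cv [v0 vpos] D0; have [ca a0 am] := aK.
have v_ge0 z : 0 <= varrho z.
  by have [->|/vpos/ltW//] := eqVneq z 0; rewrite v0.
(* Capping [r] at [alpha D] keeps [D] in [Z r], so that the infimum is never taken over an empty
   set. *)
pose Z r := [set z | 0 <= z <= D /\ Num.min r (alpha D) <= alpha z].
pose m r := inf [set varrho z | z in Z r].
have ZD r : Z r D by split; [rewrite lexx ltW|rewrite ge_min lexx orbT].
have lbZ r : has_lbound [set varrho z | z in Z r] by exists 0 => _ [z _ <-].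
have mle r z : Z r z -> m r <= varrho z.
  by move=> Zz; apply: ge_inf => //; exists z.
have m_ge0 r : 0 <= m r.
  apply: lb_le_inf; first by exists (varrho D), D.
  by move=> _ [z _ <-].
exists m; split.
- apply/eqP; rewrite eq_le m_ge0 andbT -[leRHS]v0; apply: mle; split.
    by rewrite lexx ltW.
  by rewrite ge_min a0 lexx.
- move=> r r' rr'; apply: lb_le_inf; first by exists (varrho D), D.
  move=> _ [z [zD rz] <-]; apply: mle; split=> //; apply: le_trans rz.
  by rewrite le_min !ge_min rr' lexx orbT.
- move=> r r0; have aD : 0 < alpha D by rewrite -a0 am.
  have rD : 0 < Num.min r (alpha D) by rewrite lt_min r0.
  have [|d d0 dP] := (within_continuousRP _ _).1 ca 0 _ _ rD.
    by rewrite /= in_itv/= lexx.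
  pose d' := Num.min (d / 2) D.
  have d'0 : 0 < d' by rewrite lt_min D0 divr_gt0.
  have ad' : alpha d' < Num.min r (alpha D).
    have : `|alpha d' - alpha 0| < Num.min r (alpha D).
      apply: dP; first by rewrite /= in_itv/= ltW.
      rewrite subr0 gtr0_norm// /d' gt_min; apply/orP; left; lra.
    by rewrite a0 subr0 => /(le_lt_trans (ler_norm _)).
  have [||c] := @EVT_min _ varrho d' D; first by rewrite ge_min lexx orbT.
    by apply: continuous_subspaceT.
  rewrite in_itv/= => /andP[cd cD] cmin.
  apply: (@lt_le_trans _ _ (varrho c)).
    by apply: vpos; rewrite gt_eqF// (lt_le_trans d'0).
  apply: lb_le_inf; first by exists (varrho D), D.
  move=> _ [z [/andP[z0 zD] rz] <-]; apply: cmin.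
  rewrite in_itv/= zD andbT ltW//; apply: (class_K_lt_inv aK) => //.
  exact: lt_le_trans rz.
- move=> z r zD rz; apply: mle; split=> //.
  by rewrite ge_min rz.
Qed.

(* The bound is the largest [z] with [z + u * m z <= s], made strictly
   increasing in [s] by the term [s / (1 + u)]. *)
Lemma class_KL_of_decay_rate (R : realType) (m : R -> R) :
  m 0 = 0 -> {homo m : r r' / r <= r'} -> (forall r : R, 0 < r -> 0 < m r) ->
  exists2 b : R -> R -> R, class_KL b &
    forall s u z : R, 0 <= s -> 0 <= u -> 0 <= z -> z + u * m z <= s -> z <= b s u.
Proof.
move=> m0 mono mpos.
have m_ge0 (z : R) : 0 <= z -> 0 <= m z.
  by rewrite le_eqVlt => /predU1P[<-|/mpos/ltW//]; rewrite m0.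
pose Z (s u : R) : set R := [set z | 0 <= z /\ z + u * m z <= s].
pose B (s u : R) : R := sup (Z s u).
have Z0 (s u : R) : 0 <= s -> Z s u 0 by move=> s0; split; rewrite // m0 mulr0 addr0.
have Zs (s u z : R) : 0 <= u -> Z s u z -> z <= s.
  by move=> u0 [z0]; apply: le_trans; rewrite lerDl mulr_ge0 ?m_ge0.
have hZ (s u : R) : 0 <= u -> has_ubound (Z s u) by exists s => z; exact: Zs.
have leB (s u z : R) : 0 <= u -> Z s u z -> z <= B s u.
  by move=> u0 Zz; apply: ub_le_sup => //; exact: hZ.
have B_ge0 (s u : R) : 0 <= s -> 0 <= u -> 0 <= B s u.
  by move=> s0 u0; apply: leB => //; exact: Z0.
have Ble (s u c : R) : 0 <= s -> (forall z, Z s u z -> z <= c) -> B s u <= c.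
  by move=> s0 zc; apply: ge_sup => //; exists 0; exact: Z0.
have BleS (s s' u : R) : 0 <= s -> s <= s' -> 0 <= u -> B s u <= B s' u.
  move=> s0 ss' u0; apply: Ble => // z [z0 zs]; apply: leB => //.
  by split=> //; exact: le_trans ss'.
(* Lowering an element of [Z s' u] by [s' - s] lands in [Z s u], because [m] is nondecreasing.
   Monotonicity of [m] alone thus makes [B] Lipschitz in [s], even where [m] jumps. *)
have BS (s s' u : R) : 0 <= s -> s <= s' -> 0 <= u -> B s' u <= B s u + (s' - s).
  move=> s0 ss' u0; apply: Ble; first exact: le_trans ss'.
  move=> z [z0 zs]; have [zd|zd] := leP z (s' - s).
    by have := B_ge0 _ _ s0 u0; lra.
  rewrite -lerBlDr; apply: leB => //; split; first lra.
  have : u * m (z - (s' - s)) <= u * m z by rewrite ler_wpM2l// mono//; lra.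
  by lra.
have BleU (s u u' : R) : 0 <= s -> 0 <= u -> u <= u' -> B s u' <= B s u.
  move=> s0 u0 uu'; apply: Ble => // z [z0 zs]; apply: leB => //; split=> //.
  by rewrite (le_trans _ zs)// lerD2l ler_wpM2r// m_ge0.
(* The same shift, now by [(u' - u) * m s]: elements of [Z s u] are at most [s], so the extra cost
   [(u' - u) * m z] is covered. *)
have BU (s u u' : R) : 0 <= s -> 0 <= u -> u <= u' -> B s u <= B s u' + (u' - u) * m s.
  move=> s0 u0 uu'; apply: Ble => // z Zz; have [z0 zs] := Zz.
  have u'0 : 0 <= u' by exact: le_trans uu'.
  have q0 : 0 <= (u' - u) * m s by rewrite mulr_ge0 ?m_ge0// subr_ge0.
  have [zd|zd] := leP z ((u' - u) * m s).
    by have := B_ge0 _ _ s0 u'0; lra.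
  rewrite -lerBlDr; apply: leB => //; split; first lra.
  have : u' * m (z - (u' - u) * m s) <= u' * m z.
    by rewrite ler_wpM2l// mono//; lra.
  have : (u' - u) * m z <= (u' - u) * m s.
    by rewrite ler_wpM2l ?subr_ge0// mono// (Zs _ _ _ u0 Zz).
  by lra.
pose b (s u : R) : R := B s u + s / (1 + u).
have u1 (u : R) : 0 <= u -> 0 < 1 + u by lra.
have bcont : {within [set p : R * R | 0 <= p.1 /\ 0 <= p.2],
    continuous (fun p => b p.1 p.2)}.
  apply/subspace_continuousP => -[s u] /= [s0 u0]; apply: cvgD; last first.
    apply: cvgM; first by apply: cvg_within_filter; exact: cvg_fst.
    apply: cvgV; first by rewrite gt_eqF// u1.
    apply: cvgD; first exact: cvg_cst.
    by apply: cvg_within_filter; exact: cvg_snd.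
  apply/cvgrPdist_lt => eps eps0.
  have e2 : 0 < eps / 2 by rewrite divr_gt0.
  have ms := m_ge0 _ s0.
  pose d := eps / 2 / (m s + 1); have d0 : 0 < d by rewrite divr_gt0//; lra.
  have dms : d * (m s + 1) = eps / 2 by rewrite divfK// gt_eqF//; lra.
  rewrite /prop_near1/= /nbhs/= /within/=.
  exists (ball s (eps / 2), ball u d) => /=.
    by split; exact: nbhsx_ballx.
  move=> [s' u'] /= [ss' uu'] [s'0 u'0].
  have Bs : `|B s u' - B s' u'| < eps / 2.
    apply: le_lt_trans ss'; have [le|/ltW le] := leP s s'.
      rewrite ler0_norm ?subr_le0 ?BleS// distrC ger0_norm ?subr_ge0//.
      by have := BS _ _ _ s0 le u'0; lra.
    rewrite ger0_norm ?subr_ge0 ?BleS// ger0_norm ?subr_ge0//.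
    by have := BS _ _ _ s'0 le u'0; lra.
  have Bu : `|B s u - B s u'| <= d * m s.
    apply: (@le_trans _ _ (`|u - u'| * m s)); last by rewrite ler_wpM2r// ltW.
    have [le|/ltW le] := leP u u'.
      rewrite ger0_norm ?subr_ge0 ?BleU// distrC ger0_norm ?subr_ge0//.
      by have := BU _ _ _ s0 u0 le; lra.
    rewrite ler0_norm ?subr_le0 ?BleU// ger0_norm ?subr_ge0//.
    by have := BU _ _ _ s0 u'0 le; lra.
  have := ler_distD (B s u') (B s u) (B s' u'); lra.
exists b; last first.
  move=> s u z s0 u0 z0 zs; apply: (@le_trans _ _ (B s u)); first exact: leB.
  by rewrite lerDl divr_ge0// ltW// u1.
split=> //.
- move=> u u0; split.
  + have [] : {within `[0, +oo[, continuous (fun s : R => (s, u))} /\ True.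
      split=> //; apply: continuous_subspaceT => s.
      by apply: (cvg_pair (G := nbhs s) (H := nbhs u)); [exact: (@cvg_id _ (nbhs s))|exact: cvg_cst].
    move=> cpair _; apply: (within_continuous_comp cpair _ bcont) => s /=.
    by rewrite in_itv/= andbT.
  + rewrite /b mul0r addr0; apply/eqP; rewrite eq_le B_ge0// andbT.
    by apply: Ble => // z; exact: Zs.
  + move=> s s' s0 ss'; apply: ler_ltD; first by rewrite BleS// ltW.
    by rewrite ltr_pM2r// invr_gt0 u1.
- move=> s u u' s0 u0 uu'; rewrite /b; apply: lerD; first by apply: BleU.
  have u'0 : 0 <= u' by exact: le_trans uu'.
  by apply: ler_wpM2l => //; rewrite lef_pV2 ?posrE ?u1// lerD2l.
- move=> s s0; apply/cvgrPdist_le => eps eps0.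
  have e2 : 0 < eps / 2 by rewrite divr_gt0.
  have me := mpos _ e2.
  near=> u.
  have u0 : 0 <= u by near: u; apply: nbhs_pinfty_ge; exact: num_real.
  have us : s / m (eps / 2) <= u by near: u; apply: nbhs_pinfty_ge; exact: num_real.
  have ue : s / (eps / 2) <= u by near: u; apply: nbhs_pinfty_ge; exact: num_real.
  have b0 : 0 <= b s u by rewrite addr_ge0 ?B_ge0// divr_ge0// ltW// u1.
  rewrite sub0r normrN ger0_norm//.
  have -> : eps = eps / 2 + eps / 2 by lra.
  apply: lerD; last first.
    rewrite ler_pdivrMr ?u1// mulrC -ler_pdivrMr//; lra.
  (* An element above [eps / 2] would give [u * m z >= u * m (eps / 2) >= s], leaving no room for
     [z > 0]. *)
  apply: Ble => // z [z0 zs]; rewrite leNgt; apply/negP => ez.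
  have : u * m (eps / 2) <= u * m z by rewrite ler_wpM2l// mono// ltW.
  move: us; rewrite ler_pdivrMr//; lra.
Unshelve. all: by end_near. Qed.

Lemma class_KL_comp (R : realType) (b : R -> R -> R) (alpha gamma theta : R -> R) :
  class_KL b -> class_K alpha -> class_K gamma ->
  continuous theta -> (forall t, 0 <= theta t) ->
  {homo theta : t t' / t <= t'} -> theta t @[t --> +oo] --> +oo ->
  class_KL (fun s t => alpha (b (gamma s) (theta t))).
Proof.
move=> [bc bK bmono blim] aK gK ctheta theta0 thetam thetalim.
have [ca a0 am] := aK; have [cg g0 gm] := gK.
have b_ge0 (s t : R) : 0 <= s -> 0 <= t -> 0 <= b s t.
  by move=> s0 t0; apply: class_K_ge0 (bK _ t0) _.
split.
- have cpair : {within [set p : R * R | 0 <= p.1 /\ 0 <= p.2],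
      continuous (fun p : R * R => (gamma p.1, theta p.2))}.
    apply/subspace_continuousP => -[s t] /= [s0 t0].
    apply: (cvg_pair (G := nbhs (gamma s)) (H := nbhs (theta t))) => /=.
      have cfst : {within [set p : R * R | 0 <= p.1 /\ 0 <= p.2],
          continuous (fun p : R * R => p.1)}.
        by apply: continuous_subspaceT => p; exact: cvg_fst.
      have := within_continuous_comp cfst _ cg.
      move=> /(_ _)/subspace_continuousP; apply=> //.
      by move=> p [p0 _]; rewrite /= in_itv/= p0.
    apply: cvg_within_filter; apply: (@continuous_cvg _ _ _ _ _ snd theta).
      exact: ctheta.
    exact: cvg_snd.
  have := within_continuous_comp (within_continuous_comp cpair _ bc) _ ca.
  apply.
    move=> [s t]/= [s0 t0]; split; last exact: theta0.
    exact: class_K_ge0.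
  move=> [s t]/= [s0 t0]; rewrite in_itv/= andbT; apply: b_ge0 => //.
  exact: class_K_ge0.
- move=> t t0; have [cb b0 bm] := bK _ (theta0 t); split.
  + have := within_continuous_comp (within_continuous_comp cg _ cb) _ ca.
    apply.
      by move=> s; rewrite /= !in_itv/= !andbT; exact: class_K_ge0.
    move=> s; rewrite /= !in_itv/= !andbT => s0; apply: b_ge0 => //.
    exact: class_K_ge0.
  + by rewrite g0 b0 a0.
  + move=> s s' s0 ss'; have gs0 := class_K_ge0 gK s0.
    by apply: am; [exact: b_ge0|apply: bm => //; exact: gm].
- move=> s t t' s0 t0 tt'; have gs0 := class_K_ge0 gK s0.
  apply: class_K_le => //; first exact: b_ge0.
  by apply: bmono => //; exact: thetam.
- move=> s s0; have gs0 := class_K_ge0 gK s0.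
  have blim' : b (gamma s) (theta t) @[t --> +oo] --> (0 : R).
    exact: (cvg_comp _ _ thetalim (blim _ gs0)).
  apply/cvgrPdist_lt => eps eps0.
  have [|d d0 dP] := (within_continuousRP _ _).1 ca 0 _ _ eps0.
    by rewrite /= in_itv/= lexx.
  move/cvgrPdist_lt : blim' => /(_ _ d0); apply: filterS => t bd.
  rewrite distrC -a0; apply: dP; last by rewrite distrC.
  by rewrite /= in_itv/= andbT b_ge0.
Qed.

Lemma continuous_max0 (R : realType) : continuous (Num.max (0 : R)).
Proof.
move=> y; apply/cvgrPdist_lt => eps eps0; near=> x.
have : `|y - x| < eps by near: x; exact: cvgr_dist_lt.
rewrite !ltr_norml => /andP[yx1 yx2]; rewrite /Num.max.
by case: (ltP 0 x) => x0; case: (ltP 0 y) => y0; apply/andP; split; lra.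
Unshelve. all: by end_near. Qed.

(** With [t] or [r] fixed, the time argument is an increasing affine function of the other variable,
    cut off at [0] to stay in the domain of [b]; since [tau > 0] it tends to infinity in both
    cases. *)
Lemma class_KLL_shift (R : realType) (b : R -> R -> R) (alpha gamma : R -> R)
    (tau : R) :
  0 < tau -> class_KL b -> class_K alpha -> class_K gamma ->
  class_KLL (fun s t r =>
    alpha (b (gamma s) (Num.max 0 ((t + tau * r - tau) / 2)))).
Proof.
move=> tau0 bKL aK gK r r0.
have shift (c q : R) : 0 < c ->
    [/\ continuous (fun t : R => Num.max 0 ((c * t + q) / 2)),
        {homo (fun t : R => Num.max 0 ((c * t + q) / 2)) : t t' / t <= t'} &
        Num.max 0 ((c * t + q) / 2) @[t --> +oo] --> +oo].
  move=> c0; split.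
  - move=> t; apply: (@continuous_comp _ _ _ (fun t : R => (c * t + q) / 2) (Num.max 0)).
      apply: cvgMl; apply: cvgD; last exact: cvg_cst.
      by apply: cvgMr; exact: (@cvg_id _ (nbhs t)).
    exact: continuous_max0.
  - move=> t t' tt'; have : c * t <= c * t' by rewrite ler_wpM2l// ltW.
    rewrite /Num.max; case: ltP => ?; case: ltP => ?; lra.
  - apply/cvgryPge => A; near=> t.
    have : (2 * A - q) / c <= t by near: t; apply: nbhs_pinfty_ge; exact: num_real.
    rewrite ler_pdivrMr// le_max => ?; apply/orP; right; lra.
have E1 (t : R) : (t + tau * r - tau) / 2 = (1 * t + (tau * r - tau)) / 2 by ring.
have E2 (t : R) : (r + tau * t - tau) / 2 = (tau * t + (r - tau)) / 2 by ring.
split.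
  under eq_fun do under eq_fun do rewrite E1.
  have [c1 c2 c3] := shift 1 (tau * r - tau) ltr01.
  by apply: (class_KL_comp bKL aK gK c1 _ c2 c3) => t; rewrite le_max lexx.
under eq_fun do under eq_fun do rewrite E2.
have [c1 c2 c3] := shift tau (r - tau) tau0.
by apply: (class_KL_comp bKL aK gK c1 _ c2 c3) => t; rewrite le_max lexx.
Unshelve. all: by end_near. Qed.

(** * The networked control system *)

Lemma q_x_mk (R : realType) (nx ne : nat) (x : 'rV[R]_nx) (e : 'rV[R]_ne)
    (k h : R) : q_x (mk_state x e k h) = x.
Proof. by rewrite /q_x /mk_state !row_mxKl. Qed.

Lemma q_e_mk (R : realType) (nx ne : nat) (x : 'rV[R]_nx) (e : 'rV[R]_ne)
    (k h : R) : q_e (mk_state x e k h) = e.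
Proof. by rewrite /q_e /mk_state row_mxKl row_mxKr. Qed.

Lemma q_kappa_mk (R : realType) (nx ne : nat) (x : 'rV[R]_nx) (e : 'rV[R]_ne)
    (k h : R) : q_kappa (mk_state x e k h) = k.
Proof. by rewrite /q_kappa /mk_state row_mxKr mxE. Qed.

Lemma q_eta_mk (R : realType) (nx ne : nat) (x : 'rV[R]_nx) (e : 'rV[R]_ne)
    (k h : R) : q_eta (mk_state x e k h) = h.
Proof. by rewrite /q_eta /mk_state row_mxKr mxE. Qed.

Definition q_mkE := (q_x_mk, q_e_mk, q_kappa_mk, q_eta_mk).

Lemma coord_q_x (R : realType) (nx ne : nat) (q : 'rV[R]_(nx + ne + 2)) i :
  q 0 (lshift 2 (lshift ne i)) = q_x q 0 i.
Proof. by rewrite !mxE. Qed.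

Lemma coord_q_e (R : realType) (nx ne : nat) (q : 'rV[R]_(nx + ne + 2)) i :
  q 0 (lshift 2 (rshift nx i)) = q_e q 0 i.
Proof. by rewrite !mxE. Qed.

Lemma coord_q_kappa (R : realType) (nx ne : nat)
    (q : 'rV[R]_(nx + ne + 2)) : q 0 (rshift (nx + ne) 0) = q_kappa q.
Proof. by rewrite /q_kappa mxE. Qed.

Lemma coord_q_eta (R : realType) (nx ne : nat)
    (q : 'rV[R]_(nx + ne + 2)) : q 0 (rshift (nx + ne) 1) = q_eta q.
Proof. by rewrite /q_eta mxE. Qed.

Lemma continuous_q_x (R : realType) (nx ne : nat) :
  continuous (@q_x R nx ne).
Proof.
move=> q; apply: (@cvg_mx _ _ _ _ (nbhs q) (nbhs_filter q)) => i j; rewrite (ord1 i) -coord_q_x.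
under eq_fun do rewrite -coord_q_x.
exact: coord_continuous.
Qed.

Lemma continuous_q_e (R : realType) (nx ne : nat) :
  continuous (@q_e R nx ne).
Proof.
move=> q; apply: (@cvg_mx _ _ _ _ (nbhs q) (nbhs_filter q)) => i j; rewrite (ord1 i) -coord_q_e.
under eq_fun do rewrite -coord_q_e.
exact: coord_continuous.
Qed.

Lemma continuous_q_kappa (R : realType) (nx ne : nat) :
  continuous (@q_kappa R nx ne).
Proof.
have -> : @q_kappa R nx ne = fun q => q 0 (rshift (nx + ne) 0).
  by apply/funext => q; rewrite coord_q_kappa.
exact: coord_continuous.
Qed.

Lemma continuous_q_eta (R : realType) (nx ne : nat) :
  continuous (@q_eta R nx ne).
Proof.
have -> : @q_eta R nx ne = fun q => q 0 (rshift (nx + ne) 1).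
  by apply/funext => q; rewrite coord_q_eta.
exact: coord_continuous.
Qed.

Lemma continuous_state_comp (R : realType) (nx ne : nat) (T : topologicalType)
    (F : 'rV[R]_nx -> 'rV[R]_ne -> T) :
  continuous (fun p : 'rV[R]_nx * 'rV[R]_ne => F p.1 p.2) ->
  continuous (fun q : 'rV[R]_(nx + ne + 2) => F (q_x q) (q_e q)).
Proof.
move=> cF q; have cpair : {for q, continuous (fun q => (q_x q : 'rV[R]_nx, q_e q : 'rV[R]_ne))}.
  exact: (@cvg_pair _ _ _ (nbhs q) (nbhs (q_x q)) (nbhs (q_e q)) (nbhs_filter q)
    (nbhs_filter (q_x q)) (nbhs_filter (q_e q)) (@q_x R nx ne) (@q_e R nx ne)
    (@continuous_q_x R nx ne q) (@continuous_q_e R nx ne q)).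
exact: (continuous_comp cpair (cF _)).
Qed.

(** * The attractor: closedness and distance *)

Lemma closed_nat (R : realType) : closed [set x : R | x \is a Num.nat].
Proof.
move=> x clx.
have half : 0 < 2^-1 :> R by rewrite invr_gt0.
have [_ [/natrP[m ->] mx]] := clx _ (nbhsx_ballx x _ half).
suff -> : x = m%:R by rewrite /= natr_nat.
apply/eqP; rewrite -subr_eq0 -normr_eq0; apply/negPn/negP => xm0.
have xm : 0 < `|x - m%:R| by rewrite lt_neqAle eq_sym xm0 normr_ge0.
(* If [x] differs from the natural [m] found within [1/2], a second natural lies closer still, hence
   at distance less than 1 from [m]. *)
have [_ [/natrP[k ->] kx]] := clx _ (nbhsx_ballx x _ xm).
have km : k != m by apply: contraTneq kx => ->; rewrite /ball/= ltxx.
have : `|k%:R - m%:R : R| < 1.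
  have := ler_distD x k%:R (m%:R : R); rewrite (distrC k%:R x).
  move: kx mx; rewrite /ball/=; lra.
wlog km' : k m km {mx xm0 xm kx} / (k < m)%N.
  move=> wl; have := km; rewrite neq_ltn => /orP[|mk]; first exact: wl.
  by rewrite distrC; apply: wl => //; rewrite eq_sym.
rewrite distrC ger0_norm ?subr_ge0 ?ler_nat ?(ltnW km')//.
by rewrite -natrB ?(ltnW km')// (_ : 1 = 1%:R)// ltr_nat ltnNge subn_gt0 km'.
Qed.

Lemma closed_state_space (R : realType) (nx ne : nat) :
  closed (@state_space R nx ne).
Proof.
apply: (@closed_comp _ _ (@q_kappa R nx ne) [set x | x \is a Num.nat]).
  by move=> q _; exact: continuous_q_kappa.
exact: closed_nat.
Qed.

Lemma closed_row0 (R : realType) (n : nat) : closed [set (0 : 'rV[R]_n)].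
Proof.
by apply: accessible_closed_set1; apply: hausdorff_accessible; exact: norm_hausdorff.
Qed.

Lemma closed_ncs_attractor (R : realType) (nx ne : nat) :
  closed (@ncs_attractor R nx ne).
Proof.
apply: closedI; first exact: closed_state_space.
apply: closedI.
  apply: (@closed_comp _ _ (@q_x R nx ne) [set 0]); last exact: closed_row0.
  by move=> q _; exact: continuous_q_x.
apply: (@closed_comp _ _ (@q_e R nx ne) [set 0]); last exact: closed_row0.
by move=> q _; exact: continuous_q_e.
Qed.

Lemma enorm_sqr (R : realType) (n : nat) (v : 'rV[R]_n) :
  enorm v ^+ 2 = \sum_(i < n) v 0 i ^+ 2.
Proof. by rewrite sqr_sqrtr// sumr_ge0// => i _; exact: sqr_ge0. Qed.

Lemma enorm_sqr_split (R : realType) (m n : nat) (v : 'rV[R]_(m + n)) :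
  enorm v ^+ 2 = enorm (lsubmx v) ^+ 2 + enorm (rsubmx v) ^+ 2.
Proof.
rewrite !enorm_sqr big_split_ord/=.
by congr (_ + _); apply: eq_bigr => i _; rewrite mxE.
Qed.

Lemma enorm0 (R : realType) (n : nat) : enorm (0 : 'rV[R]_n) = 0.
Proof.
by rewrite /enorm big1 ?sqrtr0// => i _; rewrite mxE expr0n.
Qed.

(** Points of the attractor have zero [x] and [e], which gives the lower bound; the point with the
    same [kappa] and [eta] as [q] gives the upper one, with [2] as a crude [sqrt 2]. The maximum is
    the form in which the Lyapunov bounds are stated. *)
Lemma dist_ncs_attractor_bounds (R : realType) (nx ne : nat)
    (q : 'rV[R]_(nx + ne + 2)) :
  state_space q ->
  Num.max (enorm (q_x q)) (enorm (q_e q)) <= dist_set (ncs_attractor (nx := nx) (ne := ne)) q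
    <= 2 * Num.max (enorm (q_x q)) (enorm (q_e q)).
Proof.
move=> kq; pose p := mk_state (0 : 'rV_nx) (0 : 'rV_ne) (q_kappa q) (q_eta q).
have Ap : ncs_attractor p by rewrite /ncs_attractor/= /state_space/= !q_mkE.
have [x0 e0] : 0 <= enorm (q_x q) /\ 0 <= enorm (q_e q) by split; exact: enorm_ge0.
apply/andP; split.
  apply: lb_le_inf; first by exists (enorm (q - p)), p.
  move=> _ [r [_ [rx re]] <-].
  have E : enorm (q - r) ^+ 2 = enorm (q_x q) ^+ 2 + enorm (q_e q) ^+ 2
      + enorm (rsubmx (q - r)) ^+ 2.
    rewrite enorm_sqr_split (enorm_sqr_split (lsubmx _)).
    by rewrite -[in RHS](subr0 (q_x q)) -rx -[in RHS](subr0 (q_e q)) -re /q_x /q_e !linearB.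
  have [x2 e2 r2] := And3 (sqr_ge0 (enorm (q_x q))) (sqr_ge0 (enorm (q_e q)))
    (sqr_ge0 (enorm (rsubmx (q - r)))).
  by rewrite ge_max -!(@ler_sqr R _ (enorm (q - r))) ?nnegrE ?enorm_ge0//; lra.
apply: (@le_trans _ _ (enorm (q - p))).
  apply: ge_inf; last by exists p.
  by exists 0 => _ [r _ <-]; exact: enorm_ge0.
have E : enorm (q - p) ^+ 2 = enorm (q_x q) ^+ 2 + enorm (q_e q) ^+ 2.
  have -> : q - p = mk_state (q_x q) (q_e q) 0 0.
    apply/rowP => i; rewrite [LHS]mxE [(- p) 0 i]mxE /p /mk_state.
    case: (splitP i) => j ij; last first.
      rewrite (_ : i = rshift (nx + ne) j); last exact/val_inj.
      rewrite !row_mxEr !mxE.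
      have [->|->] : j = 0 \/ j = 1 by case: j {ij} => [[|[|//]]] H; [left|right]; exact/val_inj.
        by rewrite coord_q_kappa subrr.
      by rewrite coord_q_eta subrr.
    rewrite (_ : i = lshift 2 j); last exact/val_inj.
    case: (splitP j) => k jk.
      rewrite (_ : j = lshift ne k); last exact/val_inj.
      by rewrite !row_mxEl [X in _ - X]mxE coord_q_x subr0.
    rewrite (_ : j = rshift nx k); last exact/val_inj.
    by rewrite !row_mxEl !row_mxEr [X in _ - X]mxE coord_q_e subr0.
  rewrite enorm_sqr_split (enorm_sqr_split (lsubmx _)) -/(q_x _) -/(q_e _) !q_mkE.
  rewrite [X in _ + X](_ : _ = 0) ?addr0// /mk_state row_mxKr.
  by rewrite enorm_sqr big1// => i _; rewrite mxE if_same expr0n.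
have z0 : 0 <= Num.max (enorm (q_x q)) (enorm (q_e q)) by rewrite le_max x0.
rewrite -ler_sqr ?nnegrE ?enorm_ge0 ?mulr_ge0// E exprMn.
have : enorm (q_x q) ^+ 2 <= Num.max (enorm (q_x q)) (enorm (q_e q)) ^+ 2.
  by rewrite ler_sqr ?nnegrE// le_max lexx.
have : enorm (q_e q) ^+ 2 <= Num.max (enorm (q_x q)) (enorm (q_e q)) ^+ 2.
  by rewrite ler_sqr ?nnegrE// le_max lexx orbT.
by have := sqr_ge0 (Num.max (enorm (q_x q)) (enorm (q_e q))); lra.
Qed.

(** * Continuity and closed invariant sets along solutions *)

Lemma solution_within_continuous (R : realType) (n : nat)
    (S : hybrid_system R n) (dom : set (R * nat)) (phi : R -> nat -> 'rV[R]_n)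
    (j : nat) (a b : R) (T : topologicalType) (F : 'rV[R]_n -> T) :
  solution S dom phi -> a <= b -> `[a, b] `<=` time_slice dom j ->
  continuous F -> {within `[a, b], continuous (fun s => F (phi s j))}.
Proof.
move=> [[_ ac] _ _ _ _] ab abI cF; apply/subspace_continuousP => s sab.
have /subspace_continuousP/(_ _ sab) := abs_continuous_continuous (ac j _ _ ab abI).
exact: (continuous_cvg _ (cF (phi s j))).
Qed.

Lemma within_itv_right_cvg (R : realType) (g : R -> R) (a b t : R) :
  {within `[a, b], continuous g} -> a <= t < b ->
  g (t + h) @[h --> 0^'+] --> g t.
Proof.
move=> /within_continuousRP cg /andP[at_ tb].
apply/cvgrPdist_lt => eps eps0.
have [|d d0 dP] := cg t _ _ eps0; first by rewrite /= in_itv/= at_ ltW.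
apply/near_right0P; exists (Num.min d (b - t)).
  by rewrite lt_min d0 subr_gt0.
move=> h h0; rewrite lt_min => /andP[hd hb]; rewrite distrC; apply: dP.
  by rewrite /= in_itv/=; apply/andP; split; lra.
by rewrite addrC addKr gtr0_norm.
Qed.

(* The flow condition is imposed on the interior of the slices only; closedness
   extends it to their endpoints. *)
Lemma solution_in_closed_set (R : realType) (n : nat)
    (S : hybrid_system R n) (A : set 'rV[R]_n) (dom : set (R * nat))
    (phi : R -> nat -> 'rV[R]_n) (t : R) (j : nat) :
  solution S dom phi -> closed A -> flow_set S `<=` A -> jump_set S `<=` A ->
  (forall q, jump_set S q -> A (jump_map S q)) ->
  dom (t, j) -> A (phi t j).
Proof.
move=> sol clA CA DA JA domtj; have [[hd ac] [dom0 phi0] flow aed jump] := sol.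
have t0 : 0 <= t by have := hd.1 _ domtj.
apply: (hybrid_induction (P := fun t j => A (phi t j)) hd dom0 domtj t0) => //.
- by case: phi0 => [/CA|/DA].
- move=> a b k; rewrite le_eqVlt => /predU1P[->//|ab] abI _.
  have cphi := abs_continuous_continuous (ac k _ _ (ltW ab) abI).
  have [_ _ cvgb] := (continuous_within_itvP _ ab).1 cphi.
  apply: (@closed_cvg _ _ _ _ _ A clA _ _ cvgb); near=> s; apply: CA; apply: flow.
  apply: itv_interior abI _; apply/andP; split; near: s.
    exact: nbhs_left_gt.
  exact: nbhs_left_lt.
- by move=> r k domk domk1 _; have [Dr ->] := jump _ _ domk domk1; exact: JA.
Unshelve. all: by end_near. Qed.

Lemma row_box_bounded (R : realType) (m n : nat) (F : 'rV[R]_m -> 'rV[R]_n -> R)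
    (D : R) :
  continuous (fun p : 'rV[R]_m * 'rV[R]_n => F p.1 p.2) -> 0 <= D ->
  exists c, forall x e, enorm x <= D -> enorm e <= D -> F x e <= c.
Proof.
move=> cF D0.
pose box k : set 'rV[R]_k := [set v | forall i, `[- D, D]%classic (v ord0 i)].
have cbox k : compact (box k) by apply: (@rV_compact R k (fun=> `[- D, D]%classic)) => i; exact: segment_compact.
have box0 k : box k 0 by move=> i; rewrite /= mxE in_itv/= oppr_le0 D0.
have boxP k (v : 'rV[R]_k) : enorm v <= D -> box k v.
  move=> vD i; rewrite /= in_itv/= -ler_norml.
  exact: le_trans (coord_le_enorm v i) vD.
have [||[x e] _ xeP] := @compact_EVT_max _ _ (fun p : 'rV[R]_m * 'rV[R]_n => F p.1 p.2)
    (box m `*` box n) _ (compact_setX (cbox m) (cbox n)).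
- by exists (0, 0); split; exact: box0.
- exact: continuous_subspaceT.
exists (F x e) => y f yD fD; apply: (xeP (y, f)).
by rewrite inE; split; exact: boxP.
Qed.

(** * Lyapunov analysis of the networked system *)

Section ncs.
Variables (R : realType) (nP nC nu : nat) (N : networked_system R nP nC nu).
Local Notation nx := (nP + nC)%N.
Local Notation ne := (nP + nu)%N.
Variables (h_e : nat -> 'rV[R]_ne -> 'rV[R]_ne) (W : R -> 'rV[R]_ne -> R).
Variables (alphaW_lo alphaW_up alphaV_lo alphaV_up varrho : R -> R).
Variables (V H : 'rV[R]_nx -> R) (L G : 'rV[R]_nx -> 'rV[R]_ne -> R).
Variables (rho a : R).
Hypothesis f_x_cont :
  continuous (fun p : 'rV[R]_nx * 'rV[R]_ne => f_x N p.1 p.2).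
Hypothesis f_e_cont :
  continuous (fun p : 'rV[R]_nx * 'rV[R]_ne => f_e N p.1 p.2).
Hypothesis W_ge0 : forall k e, 0 <= k -> 0 <= W k e.
Hypothesis W_lip : forall k, 0 <= k -> locally_lipschitz (W k).
Hypothesis alphaW_lo_K : class_Kinfty alphaW_lo.
Hypothesis alphaW_up_K : class_Kinfty alphaW_up.
Hypotheses (rho_gt0 : 0 < rho) (rho_lt1 : rho < 1).
Hypothesis W_bounds : forall (kappa : nat) e,
  alphaW_lo (enorm e) <= W kappa%:R e <= alphaW_up (enorm e).
Hypothesis W_jump : forall (kappa : nat) e,
  W kappa.+1%:R (h_e kappa e) <= rho * W kappa%:R e.
Hypothesis V_lip : locally_lipschitz V.
Hypothesis L_cont :
  continuous (fun p : 'rV[R]_nx * 'rV[R]_ne => L p.1 p.2).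
Hypothesis L_ge0 : forall x e, 0 <= L x e.
Hypothesis G_cont :
  continuous (fun p : 'rV[R]_nx * 'rV[R]_ne => G p.1 p.2).
Hypothesis G_ge0 : forall x e, 0 <= G x e.
Hypothesis alphaV_lo_K : class_Kinfty alphaV_lo.
Hypothesis alphaV_up_K : class_Kinfty alphaV_up.
Hypothesis varrho_cont : continuous varrho.
Hypothesis varrho_pd : positive_definite varrho.
Hypothesis W_flow : forall x e (kappa : nat),
  (clarke (W kappa%:R) e (f_e N x e) <= (L x e * W kappa%:R e + H x)%:E)%E.
Hypothesis V_bounds : forall x,
  alphaV_lo (enorm x) <= V x <= alphaV_up (enorm x).
Hypothesis V_flow : forall x e (kappa : nat),
  (clarke V x (f_x N x e)
     <= (- varrho (enorm x) - varrho (enorm e) - H x ^+ 2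
         + G x e * W kappa%:R e ^+ 2)%:E)%E.
Hypothesis a_gt : rho < a.

Local Notation S := (ncs_hybrid N h_e L G a rho).
Local Notation state := 'rV[R]_(nx + ne + 2).
Implicit Types (q : state) (dom : set (R * nat)) (phi : R -> nat -> state).

Let a_gt0 : 0 < a. Proof. exact: lt_trans a_gt. Qed.

Let rho2_lt1 : rho ^+ 2 < 1.
Proof. by rewrite expr_lt1// ltW. Qed.

Let arho2_gt0 : 0 < a * rho ^+ 2.
Proof. by rewrite mulr_gt0// exprn_gt0. Qed.

Let arho2_lta : a * rho ^+ 2 < a.
Proof. by rewrite gtr_pMr. Qed.

Lemma closed_flow_set : closed (flow_set S).
Proof.
apply: closedI; first exact: closed_state_space.
apply: (@closed_comp _ _ (@q_eta R nx ne) `[a * rho ^+ 2, a]).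
  by move=> q _; exact: continuous_q_eta.
exact: itv_closed.
Qed.

Lemma jump_set_sub_flow_set : jump_set S `<=` flow_set S.
Proof.
by move=> q [qk /= qeta]; split=> //=; rewrite in_itv/= qeta lexx ltW.
Qed.

Lemma jump_map_in_flow_set q : jump_set S q -> flow_set S (jump_map S q).
Proof.
move=> [/natrP[k qk] /= qeta]; split; rewrite /= /state_space/= q_mkE.
  by rewrite qk natr1 natr_nat.
by rewrite in_itv/= lexx ltW.
Qed.

Lemma solution_flow_set dom phi t j :
  solution S dom phi -> dom (t, j) -> flow_set S (phi t j).
Proof.
move=> sol; apply: solution_in_closed_set sol _ _ _ _ => //.
- exact: closed_flow_set.
- exact: jump_set_sub_flow_set.
- exact: jump_map_in_flow_set.
Qed.

Lemma flow_derivative_x dom phi j b c t i :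
  solution S dom phi -> `[b, c] `<=` time_slice dom j -> b <= t < c ->
  forall eps, 0 < eps -> \forall h \near 0^'+,
    `|q_x (phi (t + h) j) 0 i - q_x (phi t j) 0 i
      - f_x N (q_x (phi t j)) (q_e (phi t j)) 0 i * h| <= eps * h.
Proof.
move=> sol bcI tbc eps eps0.
have flowE q : flow_map S q 0 (lshift 2 (lshift ne i)) =
    f_x N (q_x q) (q_e q) 0 i by rewrite coord_q_x q_x_mk.
have := @solution_right_derivative _ _ _ _ _ _ _ _ _ (lshift 2 (lshift ne i)) sol bcI tbc.
rewrite flowE !coord_q_x.
under eq_fun do rewrite flowE.
move=> /(_ _ _ eps0); under eq_near do rewrite coord_q_x.
apply=> q; apply: (@continuous_comp _ _ _ (fun q => f_x N (q_x q) (q_e q)) (fun M => M 0 i)).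
  exact: continuous_state_comp.
exact: coord_continuous.
Qed.

Lemma flow_derivative_e dom phi j b c t i :
  solution S dom phi -> `[b, c] `<=` time_slice dom j -> b <= t < c ->
  forall eps, 0 < eps -> \forall h \near 0^'+,
    `|q_e (phi (t + h) j) 0 i - q_e (phi t j) 0 i
      - f_e N (q_x (phi t j)) (q_e (phi t j)) 0 i * h| <= eps * h.
Proof.
move=> sol bcI tbc eps eps0.
have flowE q : flow_map S q 0 (lshift 2 (rshift nx i)) =
    f_e N (q_x q) (q_e q) 0 i by rewrite coord_q_e q_e_mk.
have := @solution_right_derivative _ _ _ _ _ _ _ _ _ (lshift 2 (rshift nx i)) sol bcI tbc.
rewrite flowE !coord_q_e.
under eq_fun do rewrite flowE.
move=> /(_ _ _ eps0); under eq_near do rewrite coord_q_e.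
apply=> q; apply: (@continuous_comp _ _ _ (fun q => f_e N (q_x q) (q_e q)) (fun M => M 0 i)).
  exact: continuous_state_comp.
exact: coord_continuous.
Qed.

Lemma flow_derivative_kappa dom phi j b c t :
  solution S dom phi -> `[b, c] `<=` time_slice dom j -> b <= t < c ->
  forall eps, 0 < eps -> \forall h \near 0^'+,
    `|q_kappa (phi (t + h) j) - q_kappa (phi t j) - 0 * h| <= eps * h.
Proof.
move=> sol bcI tbc eps eps0.
have flowE q : flow_map S q 0 (rshift (nx + ne) 0) = 0.
  by rewrite coord_q_kappa q_kappa_mk.
have := @solution_right_derivative _ _ _ _ _ _ _ _ _ (rshift (nx + ne) 0) sol bcI tbc.
rewrite flowE !coord_q_kappa.
under eq_fun do rewrite flowE.
move=> /(_ _ _ eps0); under eq_near do rewrite coord_q_kappa.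
by apply=> q; apply: (@cvg_cst _ _ _ (nbhs q) (nbhs_filter q)).
Qed.

Lemma continuous_eta_rate : continuous (fun q : state =>
  - 2 * q_eta q * L (q_x q) (q_e q) - q_eta q ^+ 2 - G (q_x q) (q_e q)).
Proof.
move=> q; have ceta := @continuous_q_eta R nx ne q.
have cG := continuous_state_comp G_cont (x := q).
have cL := continuous_state_comp L_cont (x := q).
have Fq := nbhs_filter q.
exact: (cvgB (cvgB (cvgM (cvgM (cvg_cst (-2 : R) (F := nbhs q)) ceta) cL)
  (cvgM ceta ceta)) cG).
Qed.

Lemma flow_derivative_eta dom phi j b c t :
  solution S dom phi -> `[b, c] `<=` time_slice dom j -> b <= t < c ->
  forall eps, 0 < eps -> \forall h \near 0^'+,
    `|q_eta (phi (t + h) j) - q_eta (phi t j)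
      - (- 2 * q_eta (phi t j) * L (q_x (phi t j)) (q_e (phi t j))
         - q_eta (phi t j) ^+ 2 - G (q_x (phi t j)) (q_e (phi t j))) * h|
      <= eps * h.
Proof.
move=> sol bcI tbc eps eps0.
have flowE q : flow_map S q 0 (rshift (nx + ne) 1) =
    - 2 * q_eta q * L (q_x q) (q_e q) - q_eta q ^+ 2 - G (q_x q) (q_e q).
  by rewrite coord_q_eta q_eta_mk.
have := @solution_right_derivative _ _ _ _ _ _ _ _ _ (rshift (nx + ne) 1) sol bcI tbc.
rewrite flowE !coord_q_eta.
under eq_fun do rewrite flowE.
move=> /(_ _ _ eps0); under eq_near do rewrite coord_q_eta.
apply; exact: continuous_eta_rate.
Qed.

(** No regularity of [W] in its first argument is assumed, so during a flow the counter must be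
    exactly constant before [W] can be differentiated along the solution. Both the counter and its
    negative have Dini derivative at most [0]. *)
Lemma flow_kappa_constant dom phi j b c :
  solution S dom phi -> b <= c -> `[b, c] `<=` time_slice dom j ->
  q_kappa (phi c j) = q_kappa (phi b j).
Proof.
move=> sol bc bcI.
have ckappa : {within `[b, c], continuous (fun s => q_kappa (phi s j))}.
  exact: solution_within_continuous sol bc bcI (@continuous_q_kappa _ _ _).
have cNkappa : {within `[b, c], continuous (fun s => - q_kappa (phi s j))}.
  by move=> s; apply: cvgN; exact: ckappa.
have dini t : b <= t < c -> dini_le (fun s => q_kappa (phi s j)) t 0 /\
    dini_le (fun s => - q_kappa (phi s j)) t (- 0).
  by move=> tbc; apply: abs_le_dini_le; exact: flow_derivative_kappa sol bcI tbc.
have := dini_increment_le bc ckappa (fun t tbc => (dini t tbc).1).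
have := dini_increment_le bc cNkappa (fun t tbc => (dini t tbc).2).
by rewrite oppr0 !mul0r => ? ?; apply/le_anti/andP; split; lra.
Qed.

Definition lyapunov q : R := V (q_x q) + q_eta q * W (q_kappa q) (q_e q) ^+ 2.

Lemma continuous_W_q_e (k : R) :
  0 <= k -> continuous (fun q : state => W k (q_e q)).
Proof.
move=> k0 q; apply: (@continuous_comp _ _ _ (@q_e R nx ne) (W k)).
  exact: continuous_q_e.
by apply: locally_lipschitz_continuous; exact: W_lip.
Qed.

Lemma continuous_lyapunov_at (k : R) : 0 <= k ->
  continuous (fun q : state => V (q_x q) + q_eta q * W k (q_e q) ^+ 2).
Proof.
move=> k0 q; have ceta := @continuous_q_eta R nx ne q.
have cW := continuous_W_q_e k0 (x := q).
have cV : {for q, continuous (fun q : state => V (q_x q))}.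
  apply: (@continuous_comp _ _ _ (@q_x R nx ne) V).
    exact: continuous_q_x.
  exact: locally_lipschitz_continuous.
have Fq := nbhs_filter q.
exact: (cvgD cV (cvgM ceta (cvgM cW cW))).
Qed.

(* The bound is [- varrho |x| - varrho |e| - (H - eta W)^2] before the square is
   dropped. *)
Lemma lyapunov_dini_le dom phi j b c t (k : nat) :
  solution S dom phi -> b <= c -> `[b, c] `<=` time_slice dom j -> b <= t < c ->
  dini_le (fun s => V (q_x (phi s j))
                    + q_eta (phi s j) * W k%:R (q_e (phi s j)) ^+ 2) t
    (- (varrho (enorm (q_x (phi t j))) + varrho (enorm (q_e (phi t j))))).
Proof.
move=> sol bc bcI tbc; set x := q_x (phi t j); set e := q_e (phi t j).
set eta := q_eta (phi t j); set w := W k%:R e.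
have k0 : 0 <= k%:R :> R by exact: ler0n.
have [_] : flow_set S (phi t j).
  apply: solution_flow_set sol _; apply: bcI.
  by move: tbc => /andP[? ?]; rewrite /= in_itv/=; apply/andP; split; lra.
rewrite /= in_itv/= -/eta => /andP[eta_ge _].
have eta0 : 0 <= eta by exact: le_trans (ltW arho2_gt0) eta_ge.
have dV := clarke_dini_le (phi := fun s => q_x (phi s j)) (t := t) V_lip (V_flow x e k)
  (fun i => flow_derivative_x i sol bcI tbc).
have dW := clarke_dini_le (phi := fun s => q_e (phi s j)) (t := t) (W_lip k0) (W_flow x e k)
  (fun i => flow_derivative_e i sol bcI tbc).
have [deta _] := abs_le_dini_le (g := fun s => q_eta (phi s j)) (flow_derivative_eta sol bcI tbc).
have cW : W k%:R (q_e (phi (t + h) j)) @[h --> 0^'+] --> W k%:R (q_e (phi t j)).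
  apply: (within_itv_right_cvg (g := fun s => W k%:R (q_e (phi s j))) _ tbc).
  apply: (solution_within_continuous (F := fun q => W k%:R (q_e q)) sol bc bcI).
  exact: continuous_W_q_e.
have dWW := dini_le_mul_sqr (eta := fun s => q_eta (phi s j))
  (w := fun s => W k%:R (q_e (phi s j))) eta0 (fun s => W_ge0 _ k0) cW deta dW.
apply: dini_le_weaken (dini_le_add dV dWW).
have := sqr_ge0 (H x - eta * w); rewrite -/x -/e -/eta -/w; lra.
Qed.

Lemma lyapunov_flow dom phi j b c mu :
  solution S dom phi -> b <= c -> `[b, c] `<=` time_slice dom j ->
  (forall s, b <= s < c ->
     mu <= varrho (enorm (q_x (phi s j))) + varrho (enorm (q_e (phi s j)))) ->
  lyapunov (phi c j) <= lyapunov (phi b j) - mu * (c - b).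
Proof.
move=> sol bc bcI decay.
have domb : dom (b, j) by apply: bcI; rewrite /= in_itv/= lexx.
have [/natrP[k kb] _] := solution_flow_set sol domb.
rewrite /lyapunov (flow_kappa_constant sol bc bcI) kb.
have k0 : 0 <= k%:R :> R by exact: ler0n.
rewrite -lerBlDl -mulNr.
apply: (dini_increment_le (g := fun s => V (q_x (phi s j)) +
  q_eta (phi s j) * W k%:R (q_e (phi s j)) ^+ 2) bc).
  apply: (solution_within_continuous (F := fun q => V (q_x q) +
    q_eta q * W k%:R (q_e q) ^+ 2) sol bc bcI).
  exact: continuous_lyapunov_at.
move=> t tbc; apply: dini_le_weaken (lyapunov_dini_le k sol bc bcI tbc).
by rewrite lerN2 decay.
Qed.

Lemma lyapunov_jump q : jump_set S q -> lyapunov (jump_map S q) <= lyapunov q.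
Proof.
move=> [/natrP[k qk] /= qeta]; rewrite /lyapunov !q_mkE qeta qk natr1.
have -> : Num.trunc (k%:R : R) = k.
  by apply/eqP; rewrite -(eqr_nat R) truncnK ?natr_nat.
rewrite lerD2l -mulrA ler_pM2l// -exprMn ler_sqr ?nnegrE ?W_jump//.
  by apply: W_ge0; exact: ler0n.
by rewrite mulr_ge0 ?(ltW rho_gt0)// W_ge0// ler0n.
Qed.

Definition size_xe q : R := Num.max (enorm (q_x q)) (enorm (q_e q)).

(** The lower bound takes the smallest value [a * rho ^+ 2] of [eta], and a minimum because either
    of [x] and [e] may realize the maximum in [size_xe]. [alpha_up] takes the largest value [a] of
    [eta], and a sum. *)
Definition alpha_lo (s : R) : R :=
  Num.min (alphaV_lo s) (a * rho ^+ 2 * alphaW_lo s ^+ 2).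

Definition alpha_up (s : R) : R := alphaV_up s + a * alphaW_up s ^+ 2.

Lemma size_xe_ge0 q : 0 <= size_xe q.
Proof. by rewrite le_max enorm_ge0. Qed.

Lemma alpha_lo_Kinfty : class_Kinfty alpha_lo.
Proof.
apply: class_Kinfty_min => //; apply: class_Kinfty_scale => //.
exact: class_Kinfty_sqr.
Qed.

Lemma alpha_up_K : class_K alpha_up.
Proof.
apply: class_K_add; first exact: alphaV_up_K.1.
by apply: class_K_scale => //; apply: class_K_sqr; exact: alphaW_up_K.1.
Qed.

Lemma lyapunov_bounds q :
  flow_set S q -> alpha_lo (size_xe q) <= lyapunov q <= alpha_up (size_xe q).
Proof.
move=> [/natrP[k qk] /=]; rewrite in_itv/= => /andP[eta_ge eta_le].
have [x0 e0] := (enorm_ge0 (q_x q), enorm_ge0 (q_e q)).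
have /andP[Vlo Vup] := V_bounds (q_x q).
have := W_bounds k (q_e q); rewrite -qk => /andP[Wlo Wup].
have w0 : 0 <= W (q_kappa q) (q_e q) by rewrite qk W_ge0// ler0n.
have wlo0 := class_K_ge0 alphaW_lo_K.1 e0.
have wup0 := class_K_ge0 alphaW_up_K.1 e0.
have vlo0 := class_K_ge0 alphaV_lo_K.1 x0.
have eta0 : 0 <= q_eta q by exact: le_trans (ltW arho2_gt0) eta_ge.
have ww0 : 0 <= q_eta q * W (q_kappa q) (q_e q) ^+ 2 by rewrite mulr_ge0 ?sqr_ge0.
rewrite /lyapunov; apply/andP; split.
  rewrite /alpha_lo /size_xe; case: (leP (enorm (q_x q)) (enorm (q_e q))) => _.
    apply: (@le_trans _ _ (q_eta q * W (q_kappa q) (q_e q) ^+ 2)).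
      rewrite ge_min; apply/orP; right.
      by rewrite ler_pM ?sqr_ge0 ?(ltW arho2_gt0)// ler_sqr ?nnegrE.
    by rewrite lerDr (le_trans vlo0).
  by rewrite ge_min; apply/orP; left; lra.
have zx : enorm (q_x q) <= size_xe q by rewrite le_max lexx.
have ze : enorm (q_e q) <= size_xe q by rewrite le_max lexx orbT.
apply: lerD; first exact: le_trans Vup (class_K_le alphaV_up_K.1 x0 zx).
apply: ler_pM => //; first exact: sqr_ge0.
have Wz := class_K_le alphaW_up_K.1 e0 ze.
by rewrite ler_sqr ?nnegrE ?(le_trans Wup)// (le_trans wup0).
Qed.

Let varrho_ge0 s : 0 <= varrho s.
Proof.
have [v0 vpos] := varrho_pd.
by have [->|/vpos/ltW//] := eqVneq s 0; rewrite v0.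
Qed.

Lemma lyapunov_flow_nonincreasing dom phi j b c :
  solution S dom phi -> b <= c -> `[b, c] `<=` time_slice dom j ->
  lyapunov (phi c j) <= lyapunov (phi b j).
Proof.
move=> sol bc bcI; have := lyapunov_flow (mu := 0) sol bc bcI.
by rewrite mul0r subr0; apply=> s _; rewrite addr_ge0.
Qed.

Lemma lyapunov_nonincreasing dom phi t j :
  solution S dom phi -> dom (t, j) ->
  lyapunov (phi t j) <= lyapunov (phi 0 0%N).
Proof.
move=> sol domtj; have [[hd _] [dom0 _] _ _ jump] := sol.
have t0 : 0 <= t by have := hd.1 _ domtj.
apply: (hybrid_induction
  (P := fun t j => lyapunov (phi t j) <= lyapunov (phi 0 0%N)) hd dom0 domtj) => //.
- move=> b c k bc bcI; apply: le_trans.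
  exact: lyapunov_flow_nonincreasing sol bc bcI.
- move=> r k domk domk1; apply: le_trans; have [Dr ->] := jump _ _ domk domk1.
  exact: lyapunov_jump.
Qed.

(** [D] is chosen with [alpha_up Delta < alpha_lo D], which is possible because [alpha_lo] is
    unbounded; as [lyapunov] never exceeds its initial value, [alpha_lo (size_xe _)] stays below
    [alpha_lo D]. *)
Lemma solution_bounded Delta : 0 < Delta -> exists2 D, 0 < D &
  forall dom phi, solution S dom phi ->
    dist_set (ncs_attractor (nx := nx) (ne := ne)) (phi 0 0%N) < Delta ->
    forall t j, dom (t, j) -> size_xe (phi t j) <= D.
Proof.
move=> Delta0; have [loK lou] := alpha_lo_Kinfty.
have [D D0 MD] := lou (alpha_up Delta).
exists D.
  apply: (class_K_lt_inv loK) => //; have [_ -> _] := loK.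
  by rewrite (le_lt_trans _ MD)// class_K_ge0 ?(ltW Delta0)//; exact: alpha_up_K.
move=> dom phi sol dist0 t j domtj.
have [_ [dom0 _] _ _ _] := sol.
have F0 := solution_flow_set sol dom0; have Ft := solution_flow_set sol domtj.
have /andP[zd _] := dist_ncs_attractor_bounds F0.1.
have /andP[lo _] := lyapunov_bounds Ft; have /andP[_ up] := lyapunov_bounds F0.
apply: ltW; apply: (class_K_lt_inv loK) => //.
rewrite (le_lt_trans _ MD)// (le_trans lo)//.
rewrite (le_trans (lyapunov_nonincreasing sol domtj))// (le_trans up)//.
apply: class_K_le; [exact: alpha_up_K|exact: size_xe_ge0|].
by rewrite (le_trans zd)// ltW.
Qed.

(** Since [lyapunov] does not increase and [m] is nondecreasing, the rate at all earlier times is at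
    least [m] at the current value. Flows and jumps both preserve this integrated form. *)
Lemma lyapunov_decay D m dom phi :
  {homo m : r r' / r <= r'} ->
  (forall z r, 0 <= z <= D -> r <= alpha_up z -> m r <= varrho z) ->
  solution S dom phi ->
  (forall t j, dom (t, j) -> size_xe (phi t j) <= D) ->
  forall t j, dom (t, j) ->
    lyapunov (phi t j) + t * m (lyapunov (phi t j)) <= lyapunov (phi 0 0%N).
Proof.
move=> mono mdecay sol solD t j domtj; have [[hd _] [dom0 _] _ _ jump] := sol.
have t0 : 0 <= t by have := hd.1 _ domtj.
apply: (hybrid_induction (P := fun t j => lyapunov (phi t j) +
  t * m (lyapunov (phi t j)) <= lyapunov (phi 0 0%N)) hd dom0 domtj) => //.
- by rewrite mul0r addr0.
- move=> b c k bc bcI Pb.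
  have b0 : 0 <= b.
    by have /hd.1 : dom (b, k) by apply: bcI; rewrite /= in_itv/= lexx.
  (* The rate is frozen at its value at the end [c] of the interval, where it is smallest. *)
  have decay : lyapunov (phi c k) <=
      lyapunov (phi b k) - m (lyapunov (phi c k)) * (c - b).
    apply: (lyapunov_flow sol bc bcI) => s /andP[bs sc].
    have doms : dom (s, k) by apply: bcI; rewrite /= in_itv/= bs ltW.
    have scI : `[s, c] `<=` time_slice dom k.
      by apply: subset_trans bcI; apply: subset_itvr; rewrite bnd_simp.
    have Fs := solution_flow_set sol doms.
    have /andP[_ up] := lyapunov_bounds Fs.
    have zD : 0 <= size_xe (phi s k) <= D by rewrite size_xe_ge0 solD.
    have := mdecay _ _ zD
      (le_trans (lyapunov_flow_nonincreasing sol (ltW sc) scI) up).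
    have := varrho_ge0 (enorm (q_x (phi s k))).
    have := varrho_ge0 (enorm (q_e (phi s k))).
    rewrite /size_xe.
    by case: (leP (enorm (q_x (phi s k))) (enorm (q_e (phi s k)))) => _; lra.
  have : m (lyapunov (phi c k)) <= m (lyapunov (phi b k)).
    exact/mono/(lyapunov_flow_nonincreasing sol bc bcI).
  by move=> /(ler_wpM2l b0); lra.
- move=> r k domk domk1; apply: le_trans.
  have r0 : 0 <= r by have := hd.1 _ domk.
  have [Dr ->] := jump _ _ domk domk1.
  by rewrite lerD ?lyapunov_jump// ler_wpM2l// mono// lyapunov_jump.
Qed.

(* [eta + c t - (a - a rho^2) j] does not decrease: flows lose at most [c] per
   unit of time and a jump resets [eta] from [a rho^2] to [a]. *)
Lemma ncs_dwell_time Delta : 0 < Delta -> exists2 tau, 0 < tau &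
  forall dom phi, solution S dom phi ->
    dist_set (ncs_attractor (nx := nx) (ne := ne)) (phi 0 0%N) < Delta ->
    forall s i t j, dom (s, i) -> dom (t, j) -> s <= t -> (i <= j)%N ->
      j%:R - i%:R <= (t - s) / tau + 1.
Proof.
move=> Delta0; have [D D0 solD] := solution_bounded Delta0.
have [cL cLP] := row_box_bounded L_cont (ltW D0).
have [cG cGP] := row_box_bounded G_cont (ltW D0).
have cL0 : 0 <= cL by rewrite (le_trans (L_ge0 0 0))// cLP// enorm0 ltW.
have cG0 : 0 <= cG by rewrite (le_trans (G_ge0 0 0))// cGP// enorm0 ltW.
(* A bound for [2 eta L + eta^2 + G], the speed at which [eta] decreases, as [0 <= eta <= a] and
   [size_xe <= D]. *)
pose c := 2 * a * cL + a ^+ 2 + cG.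
have c0 : 0 < c.
  by rewrite /c ltr_wpDr// ltr_wpDl ?exprn_gt0// mulr_ge0// mulr_ge0// ltW.
pose gap := a - a * rho ^+ 2; have gap0 : 0 < gap by rewrite subr_gt0.
exists (gap / c); first by rewrite divr_gt0.
move=> dom phi sol dist0 s i t j domsi domtj st ij.
have [[hd _] _ _ _ jump] := sol.
have inv : q_eta (phi s i) + c * s - gap * i%:R <=
    q_eta (phi t j) + c * t - gap * j%:R.
  apply: (hybrid_induction (P := fun t j => q_eta (phi s i) + c * s - gap * i%:R <=
    q_eta (phi t j) + c * t - gap * j%:R) hd domsi domtj) => //.
  - move=> b b' k bb' bI.
    have ceta : {within `[b, b'], continuous (fun r => - q_eta (phi r k))}.
      move=> r; apply: cvgN; move: r.
      exact: solution_within_continuous sol bb' bI (@continuous_q_eta _ _ _).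
    have : - q_eta (phi b' k) - - q_eta (phi b k) <= c * (b' - b).
      apply: (dini_increment_le (g := fun r => - q_eta (phi r k)) bb' ceta) => r rb.
      have [_] := abs_le_dini_le (g := fun r => q_eta (phi r k)) (flow_derivative_eta sol bI rb).
      apply: dini_le_weaken.
      have domr : dom (r, k).
        by apply: bI; move: rb => /andP[? ?]; rewrite /= in_itv/=; apply/andP; split; lra.
      have [_] := solution_flow_set sol domr.
      rewrite /= in_itv/= => /andP[eta_ge eta_le].
      have eta0 : 0 <= q_eta (phi r k) by exact: le_trans (ltW arho2_gt0) eta_ge.
      have := solD _ _ sol dist0 _ _ domr; rewrite ge_max => /andP[xD eD].
      have Lc := cLP _ _ xD eD; have Gc := cGP _ _ xD eD.
      have : q_eta (phi r k) * L (q_x (phi r k)) (q_e (phi r k)) <= a * cL.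
        by apply: ler_pM.
      have : q_eta (phi r k) ^+ 2 <= a ^+ 2 by rewrite ler_sqr ?nnegrE// ltW.
      by rewrite /c; lra.
    lra.
  - move=> r k domk domk1; have [[_ /= qeta] ->] := jump _ _ domk domk1.
    by rewrite q_mkE qeta -natr1 /gap; lra.
have [_] := solution_flow_set sol domsi; rewrite /= in_itv/= => /andP[eta_s _].
have [_] := solution_flow_set sol domtj; rewrite /= in_itv/= => /andP[_ eta_t].
(* The two end values of [eta] differ by at most [gap]: this is the [+ 1] of the dwell-time
   inequality. *)
have : gap * (j%:R - i%:R) <= c * (t - s) + gap by rewrite /gap in inv *; lra.
rewrite -ler_pdivlMl// => /le_trans; apply.
rewrite mulrDr mulVf ?gt_eqF// lerD2r invf_div.
by rewrite mulrC -mulrA mulrCA mulrA mulrC mulrA.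
Qed.

Lemma ncs_S_GAS : S_GAS S (ncs_attractor (nx := nx) (ne := ne)).
Proof.
split; first exact: closed_ncs_attractor.
move=> Delta Delta0.
have [D D0 solD] := solution_bounded Delta0.
have [tau tau0 dwell] := ncs_dwell_time Delta0.
have [m [m0 mono mpos mdecay]] := decay_rate alpha_up_K varrho_cont varrho_pd D0.
have [b bKL bP] := class_KL_of_decay_rate m0 mono mpos.
have [loK _] := alpha_lo_Kinfty.
have [ainv ainvK ainvE] := class_Kinfty_inverse alpha_lo_Kinfty.
have ainv2K : class_K (fun y => 2 * ainv y) by exact: class_K_scale.
(* The dwell time gives [tau * (j - 1) <= t], so the mean of [t] and [tau * (j - 1)] is at most [t].
   Decay over time [t] thus implies decay over this mean, which grows with both [t] and [j]. The
   outer [2 * ainv] goes back from [lyapunov] to the distance. *)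
exists (fun s t r => 2 * ainv (b (alpha_up s) (Num.max 0 ((t + tau * r - tau) / 2)))).
  exact: (class_KLL_shift tau0 bKL ainv2K alpha_up_K).
move=> dom phi sol dist0 t j domtj.
have [[hd _] [dom0 _] _ _ _] := sol.
have t0 : 0 <= t by have := hd.1 _ domtj.
have F0 := solution_flow_set sol dom0; have Ft := solution_flow_set sol domtj.
have /andP[zd0 _] := dist_ncs_attractor_bounds F0.1.
have /andP[_ dzt] := dist_ncs_attractor_bounds Ft.1.
have /andP[lo _] := lyapunov_bounds Ft; have /andP[_ up] := lyapunov_bounds F0.
apply: le_trans dzt _; rewrite ler_pM2l//.
have z0 := size_xe_ge0 (phi t j).
have lo0 : 0 <= alpha_lo (size_xe (phi t j)) by exact: class_K_ge0.
rewrite -[leLHS]ainvE//; apply: (class_K_le ainvK) => //; apply: le_trans lo _.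
have zd : 0 <= size_xe (phi 0 0%N) by exact: size_xe_ge0.
have theta0 : 0 <= Num.max 0 ((t + tau * j%:R - tau) / 2) by rewrite le_max lexx.
have lyap0 : 0 <= lyapunov (phi t j).
  by have /andP[+ _] := lyapunov_bounds Ft; exact: le_trans.
apply: bP => //.
  by apply: (class_K_ge0 alpha_up_K); exact: le_trans zd0.
have thetat : Num.max 0 ((t + tau * j%:R - tau) / 2) <= t.
  have := dwell _ _ sol dist0 _ _ _ _ dom0 domtj t0 (leq0n _).
  rewrite !subr0 -lerBlDr ler_pdivlMr// => jt.
  by rewrite ge_max t0/=; lra.
have mt : 0 <= m (lyapunov (phi t j)).
  by rewrite -m0 mono.
have := lyapunov_decay mono mdecay sol (solD _ _ sol dist0) domtj.
have : alpha_up (size_xe (phi 0 0%N)) <=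
    alpha_up (dist_set (ncs_attractor (nx := nx) (ne := ne)) (phi 0 0%N)).
  exact: (class_K_le alpha_up_K).
by have := ler_wpM2r mt thetat; lra.
Qed.

End ncs.

Theorem theorem3 (R : realType) (nP nC nu : nat)
  (N : networked_system R nP nC nu)
  (f_x_cont : continuous (fun p : 'rV[R]_(nP + nC) * 'rV[R]_(nP + nu) =>
                            f_x N p.1 p.2))
  (f_e_cont : continuous (fun p : 'rV[R]_(nP + nC) * 'rV[R]_(nP + nu) =>
                            f_e N p.1 p.2))
  (h_e : nat -> 'rV[R]_(nP + nu) -> 'rV[R]_(nP + nu))
  (* (A) *)
  (W : R -> 'rV[R]_(nP + nu) -> R)
  (W_ge0 : forall k e, 0 <= k -> 0 <= W k e)
  (W_lip : forall k, 0 <= k -> locally_lipschitz (W k))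
  (alphaW_lo alphaW_up : R -> R)
  (alphaW_lo_K : class_Kinfty alphaW_lo)
  (alphaW_up_K : class_Kinfty alphaW_up)
  (rho : R) (rho_gt0 : 0 < rho) (rho_lt1 : rho < 1)
  (W_bounds : forall (kappa : nat) e,
     alphaW_lo (enorm e) <= W kappa%:R e <= alphaW_up (enorm e))
  (W_jump : forall (kappa : nat) e,
     W kappa.+1%:R (h_e kappa e) <= rho * W kappa%:R e)
  (* (B) *)
  (V : 'rV[R]_(nP + nC) -> R) (V_lip : locally_lipschitz V)
  (H : 'rV[R]_(nP + nC) -> R)
  (H_cont : continuous H) (H_ge0 : forall x, 0 <= H x)
  (L G : 'rV[R]_(nP + nC) -> 'rV[R]_(nP + nu) -> R)
  (L_cont : continuous (fun p : 'rV[R]_(nP + nC) * 'rV[R]_(nP + nu) =>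
                          L p.1 p.2))
  (L_ge0 : forall x e, 0 <= L x e)
  (G_cont : continuous (fun p : 'rV[R]_(nP + nC) * 'rV[R]_(nP + nu) =>
                          G p.1 p.2))
  (G_ge0 : forall x e, 0 <= G x e)
  (alphaV_lo alphaV_up : R -> R)
  (alphaV_lo_K : class_Kinfty alphaV_lo)
  (alphaV_up_K : class_Kinfty alphaV_up)
  (varrho : R -> R) (varrho_cont : continuous varrho)
  (varrho_pd : positive_definite varrho)
  (W_flow : forall x e (kappa : nat),
     (clarke (W kappa%:R) e (f_e N x e)
        <= (L x e * W kappa%:R e + H x)%:E)%E)
  (V_bounds : forall x, alphaV_lo (enorm x) <= V x <= alphaV_up (enorm x))
  (V_flow : forall x e (kappa : nat),
     (clarke V x (f_x N x e)
        <= (- varrho (enorm x) - varrho (enorm e) - H x ^+ 2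
            + G x e * W kappa%:R e ^+ 2)%:E)%E)
  (a : R) (a_gt : rho < a) :
  S_GAS (ncs_hybrid N h_e L G a rho) (ncs_attractor (nx := nP + nC) (ne := nP + nu)) /\
  semiglobal_dwell_time_outside (ncs_hybrid N h_e L G a rho)
    (ncs_attractor (nx := nP + nC) (ne := nP + nu)).
Proof.
split; first exact: (ncs_S_GAS f_x_cont f_e_cont W_ge0 W_lip alphaW_lo_K
  alphaW_up_K rho_gt0 rho_lt1 W_bounds W_jump V_lip L_cont L_ge0 G_cont G_ge0
  alphaV_lo_K alphaV_up_K varrho_cont varrho_pd W_flow V_bounds V_flow a_gt).
move=> Delta /(ncs_dwell_time f_x_cont f_e_cont W_ge0 W_lip alphaW_lo_K
  alphaW_up_K rho_gt0 rho_lt1 W_bounds W_jump V_lip L_cont L_ge0 G_cont G_ge0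
  alphaV_lo_K alphaV_up_K varrho_pd W_flow V_bounds V_flow a_gt)[tau tau0 dwell].
exists tau => // dom phi sol dist0 s i t j domsi domtj st ij _.
exact: dwell sol dist0 _ _ _ _ domsi domtj st ij.
Qed.
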